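(* If $I\subset R=\mathbf{k}[x_1,\dots,x_n]$ is a Scarf monomial ideal, then $I$ is a Mayer-Vietoris ideal of type $B1$.
   Context: $\mathbf{k}$ is a field of characteristic $0$, $R=\mathbf{k}[x_1,\dots,x_n]$. Monomial ideals are nonzero. Scarf ideals: let $I$ have minimal monomial generators $m_1,\dots,m_r$, and for $\sigma\subseteq\{1,\dots,r\}$ put $m_\sigma=\mathrm{lcm}(m_i\mid i\in\sigma)$. The Scarf complex of $I$ is the simplicial complex $\Delta_I=\{\sigma\subseteq\{1,\dots,r\}\mid m_\sigma=m_\tau\Rightarrow\sigma=\tau\}$. The algebraic Scarf complex is the complex of multigraded free modules with one basis element of multidegree $m_\sigma$ for each face $\sigma\in\Delta_I$ ($\emptyset$ in homological degree $0$), with differential $e_\sigma\mapsto\sum_{i\in\sigma}\pm\frac{m_\sigma}{m_{\sigma\setminus i}}e_{\sigma\setminus i}$ with the usual simplicial signs. $I$ is a Scarf monomial ideal if this complex is a minimal free resolution of $R/I$. Mayer-Vietoris trees: a Mayer-Vietoris tree $MVT(I)$ of $I$ is a rooted binary tree whose nodes are (labelled by) monomial ideals, with root $I$. Whenever a node $J$ has minimal monomial generating set $\{m_1,\dots,m_s\}$ with $s\geq 2$, one minimal generator (the pivot monomial) is chosen, the choice being arbitrary at each node; numbering so that the pivot is $m_s$, the node $J$ has exactly two children: the left child $\tilde J=\langle m_1,\dots,m_{s-1}\rangle\cap\langle m_s\rangle=\langle \mathrm{lcm}(m_1,m_s),\dots,\mathrm{lcm}(m_{s-1},m_s)\rangle$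 and the right child $J'=\langle m_1,\dots,m_{s-1}\rangle$. Nodes with a single minimal generator are leaves. Positions: the root has position $1$; left and right children of the node in position $p$ have positions $2p$ and $2p+1$. Dimensions: the root has dimension $0$; left and right children of a node of dimension $d$ have dimensions $d+1$ and $d$. A node is relevant if its position is $1$ or even. Type $B1$: for a tree $MVT(I)$ let $\overline{\beta}_{i,a}(I)=1$ if $x^a$ is a minimal generator of a relevant node of dimension $i$ and is not a minimal generator of any other relevant node, and $\overline{\beta}_{i,a}(I)=0$ otherwise; let $\beta_{i,a}(I)=\dim_{\mathbf{k}}\mathrm{Tor}^R_{i,a}(I,\mathbf{k})$. $I$ is a Mayer-Vietoris ideal of type $B1$ if there is a Mayer-Vietoris tree of $I$ with $\overline{\beta}_{i,a}(I)=\beta_{i,a}(I)$ for all $i\in\mathbb{N}$, $a\in\mathbb{N}^n$. *)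

(* Defs.v *)
From Stdlib Require Import ClassicalEpsilon.
From mathcomp Require Import all_boot all_order all_algebra.
From mathcomp Require Import mpoly.

Set Implicit Arguments.
Unset Strict Implicit.
Unset Printing Implicit Defensive.

Import GRing.Theory.
Local Open Scope ring_scope.

Section Monomial_ideals.

Variables (k : fieldType) (n : nat).

(* Ideals are predicates, compared extensionally. *)
Definition ideal := {mpoly k[n]} -> Prop.

(* The ideal generated by the monomials with exponent in G. *)
Definition mon_gen (G : 'X_{1..n} -> Prop) : ideal := fun f =>
  exists s : seq ('X_{1..n} * {mpoly k[n]}),
    (forall u, u \in s -> G u.1) /\ f = \sum_(u <- s) u.2 * 'X_[u.1].

Definition zero_ideal : ideal := fun f => f = 0.
Definition unit_ideal : ideal := fun _ => True.

Definition monomial_ideal (I : ideal) : Prop :=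
  (exists f, I f /\ f <> 0) /\
  exists G : 'X_{1..n} -> Prop, forall f, I f <-> mon_gen G f.

(* Minimal monomial generators: the monomials of I that are minimal for
   divisibility ([mnm_le] is the componentwise order on exponents). *)
Definition min_gen (I : ideal) (m : 'X_{1..n}) : Prop :=
  I 'X_[m] /\ forall m' : 'X_{1..n}, I 'X_[m'] -> (m' <= m)%MM -> m' = m.

Definition min_gens (I : ideal) (r : nat) (g : 'I_r -> 'X_{1..n}) : Prop :=
  injective g /\ forall m, min_gen I m <-> exists i, m = g i.

End Monomial_ideals.

Arguments zero_ideal {k n}.
Arguments unit_ideal {k n}.

Section Multigraded_resolutions.

Variables (k : fieldType) (n : nat).

(* A sequence of finitely generated multigraded free modules with maps
   F_{i+1} -> F_i.  Basis element j of F_i has multidegree [bdeg i j]; maps act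
   on row vectors, v |-> v *m [diff i].  Homogeneity and d o d = 0 are not
   fields: they are part of [resolves]. *)
Record mgseq := MgSeq {
  rk : nat -> nat;
  bdeg : forall i, 'I_(rk i) -> 'X_{1..n};
  diff : forall i, 'M[{mpoly k[n]}]_(rk i.+1, rk i) }.

(* Every map preserves multidegrees. *)
Definition homogeneous (F : mgseq) : Prop :=
  forall i (p : 'I_(rk F i.+1)) (q : 'I_(rk F i)) (m : 'X_{1..n}),
    m \in msupp (diff F i p q) -> (bdeg q + m)%MM = bdeg p.

(* H_i = 0 for all i > 0; one implication is d o d = 0. *)
Definition exact_pos (F : mgseq) : Prop :=
  forall i (v : 'rV[{mpoly k[n]}]_(rk F i.+1)),
    v *m diff F i = 0 <-> exists w, v = w *m diff F i.+1.

(* F is a multigraded free resolution of A / B, for ideals B included in A: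
   some multidegree-preserving augmentation F_0 -> A induces an isomorphism
   H_0(F) = A / B. *)
Definition resolves (F : mgseq) (A B : ideal k n) : Prop :=
  [/\ homogeneous F, exact_pos F &
   exists eps : 'cV[{mpoly k[n]}]_(rk F 0),
    [/\ forall j m, m \in msupp (eps j 0) -> m = bdeg j,
        forall v : 'rV_(rk F 0), A ((v *m eps) 0 0),
        forall f, A f -> exists v : 'rV_(rk F 0), B (f - (v *m eps) 0 0)
      & forall v : 'rV_(rk F 0),
          B ((v *m eps) 0 0) <-> exists w, v = w *m diff F 0]].

(* The image of every map lies in (x_1, .., x_n) F_i. *)
Definition minimal (F : mgseq) : Prop :=
  forall i p q, (diff F i p q)@_0%MM = 0.

(* F (x) k, where k = R / (x_1, .., x_n). *)
Definition diffk (F : mgseq) (i : nat) : 'M[k]_(rk F i.+1, rk F i) :=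
  map_mx (mcoeff 0%MM) (diff F i).

(* The row space is the part of multidegree a of F_i (x) k. *)
Definition gpart (F : mgseq) (i : nat) (a : 'X_{1..n}) : 'M[k]_(rk F i) :=
  diag_mx (\row_j (bdeg j == a)%:R).

Definition cycles (F : mgseq) (i : nat) : 'M[k]_(rk F i) :=
  match i return 'M[k]_(rk F i) with
  | 0 => 1%:M
  | j.+1 => kermx (diffk F j)
  end.

(* The dimension of H_i(F (x) k) in multidegree a. *)
Definition dim_homology (F : mgseq) (i : nat) (a : 'X_{1..n}) : nat :=
  (\rank (gpart F i a :&: cycles F i)%MS
   - \rank (gpart F i.+1 a *m diffk F i))%N.

Definition zero_mgseq : mgseq :=
  @MgSeq (fun=> 0%N) (fun _ _ => 0%MM) (fun=> 0).

(* A chosen multigraded free resolution of I; [zero_mgseq] only witnesses that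
   the type is inhabited. *)
Definition free_resolution (I : ideal k n) : mgseq :=
  epsilon (inhabits zero_mgseq) (fun F => resolves F I zero_ideal).

(* dim_k Tor_{i,a}(I, k) *)
Definition betti (I : ideal k n) (i : nat) (a : 'X_{1..n}) : nat :=
  dim_homology (free_resolution I) i a.

End Multigraded_resolutions.

Section Scarf.

Variables (k : fieldType) (n r : nat) (g : 'I_r -> 'X_{1..n}).

Definition lcm_of (s : {set 'I_r}) : 'X_{1..n} :=
  \big[@mlcm n/0%MM]_(i in s) g i.

Definition scarf_complex : {set {set 'I_r}} :=
  [set s : {set 'I_r} | [forall t : {set 'I_r},
     (lcm_of s == lcm_of t) ==> (s == t)]].

(* Faces with i elements; they index the basis in homological degree i. *)
Definition scarf_faces (i : nat) : {set {set 'I_r}} :=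
  [set s in scarf_complex | #|s| == i].

(* The coefficient of e_t in the differential of e_s: at most one j contributes,
   with sign given by its rank in s. *)
Definition scarf_coef (s t : {set 'I_r}) : {mpoly k[n]} :=
  \sum_(j in s | t == s :\ j)
    (-1) ^+ #|[set l in s | (l < j)%N]| * 'X_[(lcm_of s - lcm_of t)%MM].

Definition alg_scarf : mgseq k n :=
  @MgSeq k n
    (fun i => #|scarf_faces i|)
    (fun i p => lcm_of (enum_val p))
    (fun i => \matrix_(p, q) scarf_coef (enum_val p) (enum_val q)).

End Scarf.

Definition scarf_ideal (k : fieldType) (n : nat) (I : ideal k n) : Prop :=
  monomial_ideal I /\
  exists (r : nat) (g : 'I_r -> 'X_{1..n}),
    [/\ min_gens I g, resolves (alg_scarf k g) unit_ideal I
      & minimal (alg_scarf k g)].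

Section Mayer_Vietoris.

Variables (k : fieldType) (n : nat).

Definition right_child (J : ideal k n) (m : 'X_{1..n}) : ideal k n :=
  mon_gen (fun m' => min_gen J m' /\ m' <> m).

Definition left_child (J : ideal k n) (m : 'X_{1..n}) : ideal k n :=
  fun f => right_child J m f /\ mon_gen (fun m' => m' = m) f.

(* A tree records only the pivots; the ideals labelling the nodes are determined
   by the root ideal and the pivots, see [mv_node]. *)
Inductive mvtree :=
  | MVLeaf
  | MVNode (pivot : 'X_{1..n}) (l r : mvtree).

(* [mv_node I T p d J t]: if the root of T is labelled by I, then T has a node in
   position p, of dimension d, labelled by J, with t the subtree rooted there. *)
Inductive mv_node (I : ideal k n) (T : mvtree) :
    nat -> nat -> ideal k n -> mvtree -> Prop :=
  | mv_root : mv_node I T 1 0 I T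
  | mv_left p d J m l r : mv_node I T p d J (MVNode m l r) ->
      mv_node I T (2 * p) d.+1 (left_child J m) l
  | mv_right p d J m l r : mv_node I T p d J (MVNode m l r) ->
      mv_node I T (2 * p + 1) d (right_child J m) r.

Definition mayer_vietoris_tree (I : ideal k n) (T : mvtree) : Prop :=
  forall p d J t, mv_node I T p d J t ->
    match t with
    | MVLeaf => exists! m, min_gen J m
    | MVNode m _ _ => min_gen J m /\ exists m', min_gen J m' /\ m' <> m
    end.

Definition relevant (p : nat) : bool := (p == 1%N) || ~~ odd p.

(* x^a is a minimal generator of the relevant node in position p, of dimension d. *)
Definition rel_gen (I : ideal k n) (T : mvtree) (p d : nat) (a : 'X_{1..n}) :
    Prop :=
  relevant p /\ exists J t, mv_node I T p d J t /\ min_gen J a.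

Definition bbar (I : ideal k n) (T : mvtree) (i : nat) (a : 'X_{1..n}) : nat :=
  if excluded_middle_informative
       (exists p, rel_gen I T p i a /\
          forall q d, rel_gen I T q d a -> q = p)
  then 1%N else 0%N.

Definition type_B1 (I : ideal k n) : Prop :=
  exists T : mvtree, mayer_vietoris_tree I T /\
    forall (i : nat) (a : 'X_{1..n}), bbar I T i a = betti I i a.

End Mayer_Vietoris.

(* Main.v *)
From Stdlib Require Import ClassicalEpsilon.
Require Import Defs.
From mathcomp Require Import all_boot all_order all_algebra.
From mathcomp Require Import mpoly.

Import GRing.Theory.
Local Open Scope ring_scope.

Set Implicit Arguments.
Unset Strict Implicit.
Unset Printing Implicit Defensive.

(** The pivots do not matter.  In the tree that always pivots at the first
    generator of a node, a node of dimension d is described by a set C of d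
    indices, the pivots at which the path to the node turned left, and a list S
    of further indices: its minimal generators are the m_(C + i) for i in S, so
    every generator carries a label, the set C + i with d + 1 elements.  Left
    children put the pivot into C and drop the indices that became redundant;
    right children drop the pivot.  Two facts about labels carry the proof.

    - The label determines the relevant node ([occurs_unique]): at each node,
      the path to the label must turn left exactly when the pivot belongs to the
      label.  If s is a Scarf face, then every label with the lcm of s is s
      itself, and so x^(m_s) is a generator of at most one relevant node.
    - Labels that are Scarf faces are never dropped ([scarf_labels]).  If
      m_(D + y) divided m_(D + x) for a D inside s - y and an x in s - y, with y
      another available index, then m_s would be the lcm of s + y, hence y in s,
      and also of s - y, against the uniqueness of s.

    It follows that every Scarf multidegree is counted by the tree, in dimension
    #|s| - 1.  Conversely, let x^a be a generator of exactly one relevant node.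
    Inclusion and exclusion along the tree show that the signed sum of the labels
    whose lcm divides x^b is the indicator of x^b in I ([labels_euler]).  The
    Scarf resolution is exact in each multidegree b, so the signed sum of the
    Scarf faces below b is the same indicator ([euler_scarf]).  By triangularity
    of divisibility, the signed counts in each single multidegree agree
    ([moebius_degree], [label_count]).  In multidegree a the labels contribute
    one term, a sign, so a is the multidegree of a Scarf face.

    What remains is the algebra: the Betti numbers are computed from an arbitrary
    multigraded free resolution of I, and have to be the numbers of Scarf faces
    ([betti_scarf]).  A homogeneous matrix is determined by scalars, one per
    entry, since its entries are scalar multiples of prescribed monomials.  A
    resolution thus becomes a sequence of matrices over k, exact on the span of
    the basis elements of multidegree below b for each b, and the comparison
    theorem (lifting of chain maps, uniqueness up to homotopy) is linear algebra
    over k.  It shows that the dimension of Tor can be computed from any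
    resolution, in particular from the Scarf complex with its degree 0 removed.
    For I = R this complex is not a resolution of I, because m_{} = 1 is also the
    generator; there R resolves itself. *)

(** * Coordinate subspaces and dimensions of subquotients *)

Section CoordinateSubspaces.

Variable k : fieldType.

Definition coord_proj (q : nat) (P : pred 'I_q) : 'M[k]_q :=
  diag_mx (\row_j (P j)%:R).

Lemma coord_proj_mulE q m (P : pred 'I_q) (M : 'M[k]_(q, m)) i j :
  (coord_proj P *m M) i j = (P i)%:R * M i j.
Proof. by rewrite /coord_proj mul_diag_mx !mxE. Qed.

Lemma mul_coord_projE m q (P : pred 'I_q) (M : 'M[k]_(m, q)) i j :
  (M *m coord_proj P) i j = M i j * (P j)%:R.
Proof. by rewrite /coord_proj mul_mx_diag !mxE. Qed.

Lemma coord_proj_idem q (P : pred 'I_q) : coord_proj P *m coord_proj P = coord_proj P.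
Proof.
apply/matrixP=> i j; rewrite coord_proj_mulE !mxE.
by case: (P i); rewrite ?mul1r ?mul0r ?mul0rn.
Qed.

Lemma sub_coord_projP m q (P : pred 'I_q) (M : 'M[k]_(m, q)) :
  reflect (M *m coord_proj P = M) (M <= coord_proj P)%MS.
Proof.
apply: (iffP idP) => [/submxP [X ->]|<-]; last exact: submxMl.
by rewrite -mulmxA coord_proj_idem.
Qed.

Lemma sub_coord_proj_entriesP m q (P : pred 'I_q) (M : 'M[k]_(m, q)) :
  (forall i j, M i j != 0 -> P j) <-> (M <= coord_proj P)%MS.
Proof.
split=> [h|/sub_coord_projP h i j].
  apply/sub_coord_projP/matrixP=> i j; rewrite mul_coord_projE.
  case: (eqVneq (M i j) 0) => [->|/h ->]; first by rewrite mul0r.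
  by rewrite mulr1.
by rewrite -h mul_coord_projE; case: (P j) => //; rewrite mulr0 eqxx.
Qed.

Lemma rank_coord_proj q (P : pred 'I_q) : \rank (coord_proj P) = #|P|.
Proof.
pose S : 'M[k]_(#|P|, q) := rowsub (@enum_val _ P) 1%:M.
have freeS : row_free S.
  apply/row_freeP; exists S^T; apply/matrixP=> i j; rewrite !mxE.
  rewrite (bigD1 (enum_val i)) //= !mxE eqxx mul1r big1 ?addr0.
    by rewrite (inj_eq enum_val_inj) eq_sym.
  by move=> l hl; rewrite !mxE eq_sym (negbTE hl) mul0r.
have /eqP <- := freeS; apply/eqmx_rank/andP; split.
  apply/row_subP=> i; case: (boolP (P i)) => Pi.
    have -> : row i (coord_proj P) = row (enum_rank_in Pi i) S.
      by apply/rowP=> j; rewrite !mxE enum_rankK_in ?Pi.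
    exact: row_sub.
  have -> : row i (coord_proj P) = 0.
    by apply/rowP=> j; rewrite !mxE (negbTE Pi) ?mul0rn.
  exact: sub0mx.
apply/sub_coord_proj_entriesP=> i j; rewrite !mxE.
case: (eqVneq (enum_val i) j) => [<- _|_]; last by rewrite mulr0n eqxx.
exact: enum_valP.
Qed.

(** Read Z / B and Z' / B' as homology spaces: if f' after f differs from the
    identity on Z by elements of B, then f is injective from Z / B to Z' / B'.
    The map Z -> V' / B' induced by f has its kernel in B and its image in
    Z' / B', and rank-nullity gives the inequality. *)
Lemma sub_quotient_dim q q' m m' p p' (Z : 'M[k]_(m, q)) (B : 'M[k]_(p, q))
    (Z' : 'M[k]_(m', q')) (B' : 'M[k]_(p', q'))
    (f : 'M[k]_(q, q')) (f' : 'M[k]_(q', q)) :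
  (B' <= Z')%MS -> (Z *m f <= Z')%MS -> (B' *m f' <= B)%MS ->
  (Z *m (f *m f' - 1%:M) <= B)%MS ->
  (\rank Z - \rank B <= \rank Z' - \rank B')%N.
Proof.
move=> BZ' fZ fB hom.
set M := f *m cokermx B'.
have kerB : (Z :&: kermx M <= B)%MS.
  apply/rV_subP=> v; rewrite sub_capmx => /andP [vZ /sub_kermxP vM].
  have vB' : (v *m f <= B')%MS by rewrite submxE -mulmxA vM.
  have -> : v = v *m f *m f' - v *m (f *m f' - 1%:M).
    by rewrite mulmxBr mulmx1 mulmxA opprB addrCA subrr addr0.
  apply: addmx_sub; first by apply: submx_trans (submxMr _ vB') fB.
  by rewrite eqmx_opp; apply: submx_trans (submxMr _ vZ) hom.
have r1 := mxrank_mul_ker Z M.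
have r2 := mxrank_mul_ker Z' (cokermx B').
have r3 : (\rank B' <= \rank (Z' :&: kermx (cokermx B')))%N.
  by apply: mxrankS; rewrite sub_capmx BZ'; apply/sub_kermxP; rewrite mulmx_coker.
have r4 : (\rank (Z *m M) <= \rank (Z' *m cokermx B'))%N.
  by rewrite /M mulmxA; apply/mxrankS/submxMr.
have r5 := mxrankS kerB.
have eqB : (\rank (Z' :&: kermx (cokermx B')) <= \rank B')%N.
  apply: mxrankS; apply/rV_subP=> v; rewrite sub_capmx => /andP [_ /sub_kermxP h].
  by rewrite submxE h.
rewrite -r1 -r2 leq_subLR; apply: leq_trans (leq_add r4 r5) _.
rewrite addnC leq_add2l.
have -> : \rank (Z' :&: kermx (cokermx B'))%MS = \rank B'.
  by apply/eqP; rewrite eqn_leq eqB r3.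
by rewrite addnK.
Qed.

End CoordinateSubspaces.

(** * Matrices that do not raise the multidegree *)

Section LowMatrices.

Variables (k : fieldType) (n : nat).
Implicit Type b : 'X_{1..n}.

(** The row space is the span of the basis elements of multidegree dividing b:
    the scalar shadow of the multidegree b part of a free module, where the basis
    element of multidegree d stands for its multiple by x^(b - d). *)
Definition below q (d : 'I_q -> 'X_{1..n}) b : 'M[k]_q :=
  coord_proj k (fun j => (d j <= b)%MM).

(** The condition under which a scalar matrix comes from a homogeneous matrix of
    polynomials: the entry (i, j) sits in front of x^(c i - d j). *)
Definition low m q (c : 'I_m -> 'X_{1..n}) (d : 'I_q -> 'X_{1..n})
    (M : 'M[k]_(m, q)) : Prop :=
  forall i j, M i j != 0 -> (d j <= c i)%MM.

Lemma low_row m q (c : 'I_m -> 'X_{1..n}) (d : 'I_q -> 'X_{1..n}) M i :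
  low c d M -> (row i M <= below d (c i))%MS.
Proof. by move=> lM; apply/sub_coord_proj_entriesP=> i' j; rewrite mxE => /lM. Qed.

Lemma low_below m q (c : 'I_m -> 'X_{1..n}) (d : 'I_q -> 'X_{1..n}) M b :
  low c d M -> (below c b *m M <= below d b)%MS.
Proof.
move=> lM; apply/sub_coord_proj_entriesP=> i j; rewrite coord_proj_mulE.
case: (boolP (c i <= b)%MM) => [le|_]; last by rewrite mul0r eqxx.
by rewrite mul1r => /lM /lepm_trans; apply.
Qed.

Lemma low_mul l m q (c : 'I_l -> 'X_{1..n}) (d : 'I_m -> 'X_{1..n})
    (e : 'I_q -> 'X_{1..n}) M N :
  low c d M -> low d e N -> low c e (M *m N).
Proof.
move=> lM lN i j; rewrite mxE; case: (boolP (e j <= c i)%MM) => // nle.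
rewrite big1 ?eqxx // => h _; apply/eqP; rewrite mulf_eq0.
case: eqVneq => //= /lM le1; case: eqVneq => //= /lN le2.
by rewrite (lepm_trans le2 le1) in nle.
Qed.

Lemma low_sub m q (c : 'I_m -> 'X_{1..n}) (d : 'I_q -> 'X_{1..n}) M N :
  low c d M -> low c d N -> low c d (M - N).
Proof.
move=> lM lN i j; rewrite !mxE; case: (eqVneq (M i j) 0) => [->|/lM //].
by rewrite sub0r oppr_eq0 => /lN.
Qed.

Lemma low1 q (c : 'I_q -> 'X_{1..n}) : low c c 1%:M.
Proof.
move=> i j; rewrite mxE; case: (eqVneq i j) => [->|_]; first by rewrite lepm_refl.
by rewrite mulr0n eqxx.
Qed.

(** Solves X *m D = M with [low c d X]: row i of M is lifted inside the span of
    the basis elements below c i.  The pseudo-inverse makes the choice. *)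
Definition graded_lift m q l (c : 'I_m -> 'X_{1..n}) (d : 'I_q -> 'X_{1..n})
    (D : 'M[k]_(q, l)) (M : 'M[k]_(m, l)) : 'M[k]_(m, q) :=
  \matrix_i (row i M *m pinvmx (below d (c i) *m D) *m below d (c i)).

Lemma low_graded_lift m q l c d D M : low c d (@graded_lift m q l c d D M).
Proof.
move=> i j; rewrite -[X in X != 0]mul1r mxE mul_coord_projE.
by case: (d j <= c i)%MM => //; rewrite mulr0 mulr0 eqxx.
Qed.

Lemma graded_liftK m q l c d D M :
  (forall i, (row i M <= below d (c i) *m D)%MS) ->
  @graded_lift m q l c d D M *m D = M.
Proof.
move=> h; apply/row_matrixP=> i; rewrite row_mul rowK -mulmxA.
exact: mulmxKpV.
Qed.

(** Reduction modulo the maximal ideal: an entry of a homogeneous matrix has a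
    constant term only when the multidegrees of its row and column agree. *)
Definition modm m q (c : 'I_m -> 'X_{1..n}) (d : 'I_q -> 'X_{1..n})
    (M : 'M[k]_(m, q)) : 'M[k]_(m, q) :=
  \matrix_(i, j) (M i j *+ (c i == d j)).

Lemma lepm_anti (b b' : 'X_{1..n}) : (b <= b')%MM -> (b' <= b)%MM -> b = b'.
Proof.
move=> /mnm_lepP h /mnm_lepP h'; apply/mnmP=> i.
by apply/eqP; rewrite eqn_leq h h'.
Qed.

(** If the outer degrees agree, an intermediate degree is squeezed between them,
    so no other terms of the product survive. *)
Lemma modm_mul l m q (c : 'I_l -> 'X_{1..n}) (d : 'I_m -> 'X_{1..n})
    (e : 'I_q -> 'X_{1..n}) M N :
  low c d M -> low d e N -> modm c e (M *m N) = modm c d M *m modm d e N.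
Proof.
move=> lM lN; apply/matrixP=> i j; rewrite !mxE -sumrMnl.
apply: eq_bigr => h _; rewrite !mxE.
have [->|/lM le1] := eqVneq (M i h) 0; first by rewrite !mul0rn !mul0r mul0rn.
have [->|/lN le2] := eqVneq (N h j) 0; first by rewrite !mul0rn !mulr0 mul0rn.
case: (eqVneq (c i) (e j)) => [eq|ne].
  rewrite eq in le1; have -> := lepm_anti le1 le2.
  by rewrite !eqxx eq !eqxx !mulr1n.
case: (eqVneq (c i) (d h)) => [<-|_]; last by rewrite !mulr0n mul0r.
by rewrite (negbTE ne) !mulr0n mulr0.
Qed.

Lemma modmD m q (c : 'I_m -> 'X_{1..n}) (d : 'I_q -> 'X_{1..n}) M N :
  modm c d (M + N) = modm c d M + modm c d N.
Proof. by apply/matrixP=> i j; rewrite !mxE mulrnDl. Qed.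

Lemma modmB m q (c : 'I_m -> 'X_{1..n}) (d : 'I_q -> 'X_{1..n}) M N :
  modm c d (M - N) = modm c d M - modm c d N.
Proof. by apply/matrixP=> i j; rewrite !mxE mulrnBl. Qed.

Lemma modm1 q (c : 'I_q -> 'X_{1..n}) : modm c c 1%:M = 1%:M.
Proof.
by apply/matrixP=> i j; rewrite !mxE; case: (eqVneq i j) => [->|]; rewrite ?eqxx ?mul0rn.
Qed.

Lemma modm0 m q (c : 'I_m -> 'X_{1..n}) (d : 'I_q -> 'X_{1..n}) :
  modm c d 0 = 0.
Proof. by apply/matrixP=> i j; rewrite !mxE mul0rn. Qed.

Lemma modm_gpart m q (c : 'I_m -> 'X_{1..n}) (d : 'I_q -> 'X_{1..n}) M a :
  coord_proj k (fun i => c i == a) *m modm c d M =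
  modm c d M *m coord_proj k (fun j => d j == a).
Proof.
apply/matrixP=> i j; rewrite coord_proj_mulE mul_coord_projE !mxE.
case: (eqVneq (c i) (d j)) => [->|]; first by rewrite mulrC.
by rewrite mulr0n mulr0 mul0r.
Qed.

End LowMatrices.

(** * Homogeneous matrices as scalar matrices *)

Section HomogeneousMatrices.

Variables (k : fieldType) (n : nat).

Definition homogeneous_mx m q (c : 'I_m -> 'X_{1..n}) (d : 'I_q -> 'X_{1..n})
    (M : 'M[{mpoly k[n]}]_(m, q)) : Prop :=
  forall i j e, e \in msupp (M i j) -> (d j + e)%MM = c i.

Definition strand_mx m q (c : 'I_m -> 'X_{1..n}) (d : 'I_q -> 'X_{1..n})
    (M : 'M[{mpoly k[n]}]_(m, q)) : 'M[k]_(m, q) :=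
  \matrix_(i, j) (M i j)@_(c i - d j).

(** Multiplying each basis element up to multidegree b identifies scalar vectors
    supported below b with homogeneous vectors of multidegree b. *)
Definition pad q (d : 'I_q -> 'X_{1..n}) b (v : 'rV[k]_q) :
    'rV[{mpoly k[n]}]_q :=
  \row_j (if (d j <= b)%MM then v 0 j *: 'X_[b - d j] else 0).

(** The component of multidegree b of a vector of polynomials, as scalars. *)
Definition strip q (d : 'I_q -> 'X_{1..n}) b (W : 'rV[{mpoly k[n]}]_q) :
    'rV[k]_q :=
  \row_j (if (d j <= b)%MM then (W 0 j)@_(b - d j) else 0).

Lemma homogeneous_mx_entry m q c d (M : 'M[{mpoly k[n]}]_(m, q)) i j :
  homogeneous_mx c d M -> M i j = strand_mx c d M i j *: 'X_[c i - d j].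
Proof.
move=> hM; apply/mpolyP=> e; rewrite mcoeffZ mcoeffX mxE.
case: (eqVneq (c i - d j)%MM e) => [<-|ne]; first by rewrite mulr1.
rewrite mulr0; apply/eqP; rewrite mcoeff_eq0; apply/negP=> /hM eq.
by move: ne; rewrite -eq addmC addmK eqxx.
Qed.

Lemma low_strand_mx m q c d (M : 'M[{mpoly k[n]}]_(m, q)) :
  homogeneous_mx c d M -> low c d (strand_mx c d M).
Proof.
by move=> hM i j; rewrite mxE -mcoeff_msupp => /hM <-; rewrite lem_addr.
Qed.

Lemma strip_below q (d : 'I_q -> 'X_{1..n}) b W : (strip d b W <= below k d b)%MS.
Proof.
by apply/sub_coord_proj_entriesP=> i j; rewrite mxE; case: ifP => //; rewrite eqxx.
Qed.

Lemma padK q (d : 'I_q -> 'X_{1..n}) b v :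
  (v <= below k d b)%MS -> strip d b (pad d b v) = v.
Proof.
move=> /sub_coord_proj_entriesP h; apply/rowP=> j; rewrite !mxE.
case: (boolP (d j <= b)%MM) => [le|]; first by rewrite mcoeffZ mcoeffX eqxx mulr1.
by have [->//|/h ->] := eqVneq (v 0 j) 0.
Qed.

Lemma pad0 q (d : 'I_q -> 'X_{1..n}) b : pad d b (0 : 'rV[k]_q) = 0.
Proof. by apply/rowP=> j; rewrite !mxE scale0r if_same. Qed.

Lemma strip0 q (d : 'I_q -> 'X_{1..n}) b : strip d b 0 = 0.
Proof. by apply/rowP=> j; rewrite !mxE mcoeff0 if_same. Qed.

Lemma strip_mul m q c d (M : 'M[{mpoly k[n]}]_(m, q)) b W :
  homogeneous_mx c d M -> strip d b (W *m M) = strip c b W *m strand_mx c d M.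
Proof.
move=> hM; have lM := low_strand_mx hM.
apply/rowP=> j; rewrite mxE [RHS]mxE.
have [le|nle] := boolP (d j <= b)%MM; last first.
  rewrite big1 // => i _; rewrite [strip _ _ _ 0 i]mxE.
  case: ifP => le; last by rewrite mul0r.
  have [->|/lM le'] := eqVneq (strand_mx c d M i j) 0; first by rewrite mulr0.
  by rewrite (lepm_trans le' le) in nle.
rewrite mxE linear_sum; apply: eq_bigr => i _.
rewrite [strip _ _ _ 0 i]mxE (homogeneous_mx_entry i j hM) /=.
have [->|/lM le'] := eqVneq (strand_mx c d M i j) 0.
  by rewrite scale0r mulr0 mcoeff0 mulr0.
rewrite -scalerAr mcoeffZ mulrC.
congr (_ * _); case: ifP => le2.
  have -> : (b - d j = (b - c i) + (c i - d j))%MM.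
    by rewrite -{1}(submK le2) addmBA.
  by rewrite addmC mcoeffMX.
apply/eqP; rewrite mcoeff_eq0; apply: contraFN le2 => /msuppM_le /allpairsP.
case=> -[e1 e2] /= [_]; rewrite msuppX inE => /eqP -> eq.
have := submK le; rewrite eq -addmA (submK le') => <-.
exact: lem_addl.
Qed.

Lemma pad_mul m q c d (M : 'M[{mpoly k[n]}]_(m, q)) b (v : 'rV[k]_m) :
  homogeneous_mx c d M -> (v <= below k c b)%MS ->
  pad c b v *m M = pad d b (v *m strand_mx c d M).
Proof.
move=> hM /sub_coord_proj_entriesP hv; have lM := low_strand_mx hM.
apply/rowP=> j; rewrite mxE [RHS]mxE.
have [le|nle] := boolP (d j <= b)%MM; last first.
  rewrite big1 // => i _; rewrite mxE (homogeneous_mx_entry i j hM).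
  case: ifP => le; last by rewrite mul0r.
  have [->|/lM le'] := eqVneq (strand_mx c d M i j) 0; first by rewrite scale0r mulr0.
  by rewrite (lepm_trans le' le) in nle.
rewrite mxE scaler_suml; apply: eq_bigr => i _.
rewrite [pad _ _ _ 0 i]mxE (homogeneous_mx_entry i j hM).
have [->|/lM le'] := eqVneq (strand_mx c d M i j) 0.
  by rewrite scale0r !mulr0 scale0r.
have [->|/hv le2] := eqVneq (v 0 i) 0.
  by rewrite scale0r if_same !mul0r scale0r.
rewrite le2 -scalerAl -scalerAr scalerA -mpolyXD; congr (_ *: 'X_[_]).
by rewrite -{2}(submK le2) addmBA.
Qed.

End HomogeneousMatrices.

(** * Comparison of resolutions, over the base field *)

Section StrandwiseExactness.

Variables (k : fieldType) (n : nat).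
Implicit Types (F G : mgseq k n) (P : 'X_{1..n} -> Prop).

Definition strand_diff F i : 'M[k]_(rk F i.+1, rk F i) :=
  strand_mx (@bdeg _ _ F i.+1) (@bdeg _ _ F i) (diff F i).

Notation blw F i := (below k (@bdeg k n F i)).

(** Exactness of the augmented sequence ... -> F_1 -> F_0 -> P -> 0 in every
    multidegree b, where P stands for the monomials of an ideal, one-dimensional
    in each multidegree of P and zero elsewhere. *)
Record strand_resolution F (e : 'cV[k]_(rk F 0)) P : Prop := StrandResolution {
  str_low : forall i, low (@bdeg _ _ F i.+1) (@bdeg _ _ F i) (strand_diff F i);
  str_exact : forall i b,
    ((blw F i.+1 b :&: kermx (strand_diff F i))%MS
       :=: blw F i.+2 b *m strand_diff F i.+1)%MS;
  str_exact0 : forall b,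
    ((blw F 0 b :&: kermx e)%MS :=: blw F 1 b *m strand_diff F 0)%MS;
  str_aug : forall b, P b -> exists2 v : 'rV_(rk F 0),
    (v <= blw F 0 b)%MS & v *m e = 1%:M;
  str_augN : forall j, e j 0 != 0 -> P (bdeg j) }.

Arguments strand_resolution F e P : clear implicits.
Arguments str_low {F e P} _ i.

Lemma row_mul_below m (F : mgseq k n) i (M : 'M[k]_(rk F i, m)) p b :
  (bdeg p <= b)%MM -> (row p M <= blw F i b *m M)%MS.
Proof.
move=> le; have -> : row p M = row p (blw F i b *m M).
  by apply/rowP=> j; rewrite mxE [RHS]mxE coord_proj_mulE le mul1r.
exact: row_sub.
Qed.

Lemma strand_d2 F e P i : strand_resolution F e P ->
  strand_diff F i.+1 *m strand_diff F i = 0.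
Proof.
move=> sF; apply/row_matrixP=> p; rewrite row_mul row0; apply/sub_kermxP.
apply: submx_trans (row_mul_below _ (lepm_refl _)) _.
by rewrite -(str_exact sF i (bdeg p)) capmxSr.
Qed.

Lemma strand_d2_aug F e P : strand_resolution F e P -> strand_diff F 0 *m e = 0.
Proof.
move=> sF; apply/row_matrixP=> p; rewrite row_mul row0; apply/sub_kermxP.
apply: submx_trans (row_mul_below _ (lepm_refl _)) _.
by rewrite -(str_exact0 sF (bdeg p)) capmxSr.
Qed.

Section ComparisonMap.

Variables (F G : mgseq k n) (eF : 'cV[k]_(rk F 0)) (eG : 'cV[k]_(rk G 0)).
Variable P : 'X_{1..n} -> Prop.
Hypotheses (sF : strand_resolution F eF P) (sG : strand_resolution G eG P).

(** A chain map over the identity of P, lifted degree by degree. *)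
Fixpoint comparison_map i : 'M[k]_(rk F i, rk G i) :=
  match i return 'M[k]_(rk F i, rk G i) with
  | 0 => graded_lift (@bdeg _ _ F 0) (@bdeg _ _ G 0) eG eF
  | j.+1 => graded_lift (@bdeg _ _ F j.+1) (@bdeg _ _ G j.+1) (strand_diff G j)
              (strand_diff F j *m comparison_map j)
  end.

Lemma comparison_map_low i : low (@bdeg _ _ F i) (@bdeg _ _ G i) (comparison_map i).
Proof. by case: i => [|i]; apply: low_graded_lift. Qed.

Arguments comparison_map_low i : clear implicits.

Lemma comparison_map_aug : comparison_map 0 *m eG = eF.
Proof.
apply: graded_liftK => p.
have [z|nz] := eqVneq (eF p 0) 0.
  suff -> : row p eF = 0 by apply: sub0mx.
  by apply/rowP=> j; rewrite !mxE ord1.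
have [v vb ve] := str_aug sG (str_augN sF nz).
apply: submx_trans (submxMr eG vb); rewrite ve.
exact: submx1.
Qed.

Lemma comparison_map_diff i :
  comparison_map i.+1 *m strand_diff G i = strand_diff F i *m comparison_map i.
Proof.
elim: i => [|i IH]; apply: graded_liftK => p.
  have lM := low_mul (str_low sF 0) (comparison_map_low 0).
  rewrite -(str_exact0 sG) sub_capmx (low_row _ lM) /=.
  apply/sub_kermxP; rewrite -row_mul -mulmxA comparison_map_aug (strand_d2_aug sF).
  exact: row0.
have lM := low_mul (str_low sF i.+1) (comparison_map_low i.+1).
rewrite -(str_exact sG) sub_capmx (low_row _ lM) /=.
apply/sub_kermxP; rewrite -row_mul -mulmxA IH mulmxA (strand_d2 _ sF) mul0mx.
exact: row0.
Qed.

End ComparisonMap.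

(** A chain map that augments to zero is homotopic to zero.  The homotopy is
    built upwards; only its two consecutive components around each degree are
    recorded, which is what homology in that degree needs. *)
Lemma null_homotopy F eF P (x : forall i, 'M[k]_(rk F i)) :
  strand_resolution F eF P ->
  (forall i, low (@bdeg _ _ F i) (@bdeg _ _ F i) (x i)) ->
  x 0 *m eF = 0 ->
  (forall i, x i.+1 *m strand_diff F i = strand_diff F i *m x i) ->
  (exists2 h, low (@bdeg _ _ F 0) (@bdeg _ _ F 1) h & x 0 = h *m strand_diff F 0) /\
  (forall i, exists h h',
    [/\ low (@bdeg _ _ F i) (@bdeg _ _ F i.+1) h,
        low (@bdeg _ _ F i.+1) (@bdeg _ _ F i.+2) h' &
        x i.+1 = strand_diff F i *m h + h' *m strand_diff F i.+1]).
Proof.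
move=> sF lx x0 xd.
have H0 : exists2 h, low (@bdeg _ _ F 0) (@bdeg _ _ F 1) h & x 0 = h *m strand_diff F 0.
  exists (graded_lift (@bdeg _ _ F 0) (@bdeg _ _ F 1) (strand_diff F 0) (x 0)).
    exact: low_graded_lift.
  rewrite graded_liftK // => p.
  rewrite -(str_exact0 sF) sub_capmx (low_row _ (lx 0%N)) /=.
  by apply/sub_kermxP; rewrite -row_mul x0 row0.
have step i h : low (@bdeg _ _ F i) (@bdeg _ _ F i.+1) h ->
    (x i.+1 - strand_diff F i *m h) *m strand_diff F i = 0 ->
    exists h', low (@bdeg _ _ F i.+1) (@bdeg _ _ F i.+2) h' /\
      x i.+1 = strand_diff F i *m h + h' *m strand_diff F i.+1.
  move=> lh z; set y := x i.+1 - _ in z.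
  have ly : low (@bdeg _ _ F i.+1) (@bdeg _ _ F i.+1) y.
    by apply: low_sub => //; apply: low_mul (str_low sF i) lh.
  exists (graded_lift (@bdeg _ _ F i.+1) (@bdeg _ _ F i.+2) (strand_diff F i.+1) y).
  split; first exact: low_graded_lift.
  rewrite graded_liftK; first by rewrite /y [RHS]addrC subrK.
  move=> p.
  rewrite -(str_exact sF) sub_capmx (low_row _ ly) /=.
  by apply/sub_kermxP; rewrite -row_mul z row0.
split=> //; elim=> [|i [h [h' [lh lh' eq]]]].
  have [h lh eq] := H0; have [||h' [lh' eq']] := step 0%N h => //.
    by rewrite mulmxBl xd -mulmxA -eq subrr.
  by exists h, h'.
have [||h'' [lh'' eq'']] := step i.+1 h' => //.
  rewrite mulmxBl xd -mulmxA.
  have -> : h' *m strand_diff F i.+1 = x i.+1 - strand_diff F i *m h.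
    by rewrite eq [X in X - _]addrC addrK.
  by rewrite mulmxBr mulmxA (strand_d2 _ sF) mul0mx subr0 subrr.
by exists h', h''.
Qed.

End StrandwiseExactness.

Arguments strand_resolution {k n} F e P.
Arguments str_low {k n F e P} _ i.

(** * Monomial ideals *)

Section MonomialIdeals.

Variables (k : fieldType) (n : nat).
Implicit Types (G : 'X_{1..n} -> Prop) (I : ideal k n).

Lemma mon_gen_msupp G (f : {mpoly k[n]}) m :
  mon_gen G f -> m \in msupp f -> exists2 g, G g & (g <= m)%MM.
Proof.
case=> s [hs ->]; elim: s hs => [|u s IH] hs; first by rewrite big_nil msupp0.
rewrite big_cons => /msuppD_le; rewrite mem_cat => /orP [|h]; last first.
  by apply: IH h => v vs; apply: hs; rewrite inE vs orbT.
move=> /msuppM_le /allpairsP [[e1 e2] /= [_]].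
rewrite msuppX inE => /eqP -> ->; exists u.1; last exact: lem_addl.
by apply: hs; rewrite inE eqxx.
Qed.

Lemma mon_genX G m :
  @mon_gen k n G 'X_[m] <-> exists2 g, G g & (g <= m)%MM.
Proof.
split=> [h|[g Gg le]]; first by apply: mon_gen_msupp h _; rewrite msuppX inE.
exists [:: (g, 'X_[m - g])]; split; first by move=> u; rewrite inE => /eqP ->.
by rewrite big_seq1 /= -mpolyXD submK.
Qed.

Lemma monomial_ideal_msupp I f m :
  monomial_ideal I -> I f -> m \in msupp f -> I 'X_[m].
Proof.
case=> _ [G IG] /IG If mf; apply/IG/mon_genX.
exact: mon_gen_msupp If mf.
Qed.

Lemma monomial_ideal_le I m m' :
  monomial_ideal I -> I 'X_[m] -> (m <= m')%MM -> I 'X_[m'].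
Proof.
case=> _ [G IG] /IG /mon_genX [g Gg le] le'; apply/IG/mon_genX.
by exists g => //; apply: lepm_trans le le'.
Qed.

Lemma min_gen_below I m : I 'X_[m] -> exists2 g, min_gen I g & (g <= m)%MM.
Proof.
have [N] := ubnP (mdeg m); elim: N m => // N IH m; rewrite ltnS => lt Im.
have [[m' [Im' le ne]]|h] :=
    excluded_middle_informative (exists m', [/\ I 'X_[m'], (m' <= m)%MM & m' <> m]).
  have lt' : (mdeg m' < mdeg m)%N.
    rewrite -(submK le) mdegD -[X in (X < _)%N]add0n ltn_add2r lt0n mdeg_eq0.
    apply/eqP=> z; apply: ne; rewrite -(submK le) z; exact/esym/add0m.
  have [g mg le2] := IH m' (leq_trans lt' lt) Im'.
  by exists g => //; apply: lepm_trans le2 le.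
exists m; last exact: lepm_refl; split=> // m' Im' le.
by have [//|ne] := excluded_middle_informative (m' = m); case: h; exists m'.
Qed.

End MonomialIdeals.

(** * From free resolutions to strands *)

Section TransferToStrands.

Variables (k : fieldType) (n : nat).
Implicit Types (F G : mgseq k n) (I : ideal k n).

Lemma capmx_kerP m q l (U : 'M[k]_(m, q)) (D : 'M_(q, l)) p (V : 'M[k]_(p, q)) :
  (forall v : 'rV_q, (v <= U)%MS -> v *m D = 0 <-> (v <= V)%MS) ->
  (V <= U)%MS -> ((U :&: kermx D)%MS :=: V)%MS.
Proof.
move=> h VU; apply/eqmxP/andP; split; apply/rV_subP=> v.
  by rewrite sub_capmx => /andP [/h vU /sub_kermxP /vU].
move=> vV; have vU := submx_trans vV VU.
by rewrite sub_capmx vU; apply/sub_kermxP/h.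
Qed.

(** [pad] and [strip] carry cycles and boundaries back and forth: a scalar cycle
    is padded, bounded over the polynomial ring, and the bounding vector is
    stripped to its component of multidegree b. *)
Lemma strand_exactness l m q (c : 'I_l -> 'X_{1..n}) (d : 'I_m -> 'X_{1..n})
    (e : 'I_q -> 'X_{1..n}) (M : 'M[{mpoly k[n]}]_(l, m)) (N : 'M_(m, q)) b :
  homogeneous_mx c d M -> homogeneous_mx d e N ->
  (forall v : 'rV_m, v *m N = 0 <-> exists w, v = w *m M) ->
  ((below k d b :&: kermx (strand_mx d e N))%MS :=: below k c b *m strand_mx c d M)%MS.
Proof.
move=> hM hN ex; apply: capmx_kerP; last exact/low_below/low_strand_mx.
move=> v vb; split=> [z|].
  have /ex [w eq] : pad d b v *m N = 0 by rewrite (pad_mul hN vb) z pad0.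
  rewrite -(padK vb) eq (strip_mul _ _ hM); apply: submxMr; exact: strip_below.
move=> /submxP [u eq]; set w := u *m below k c b.
have wb : (w <= below k c b)%MS by exact: submxMl.
have eqv : v = w *m strand_mx c d M by rewrite eq mulmxA.
have padv : pad d b v = pad c b w *m M by rewrite (pad_mul hM wb) eqv.
have /(congr1 (strip e b)) : pad d b v *m N = 0 by apply/ex; exists (pad c b w).
by rewrite (strip_mul _ _ hN) padK // strip0.
Qed.

Lemma homogeneous_diff F i : homogeneous F ->
  homogeneous_mx (@bdeg _ _ F i.+1) (@bdeg _ _ F i) (diff F i).
Proof. by move=> hF p q m; apply: hF. Qed.

(** Since I is generated by monomials, the image of a basis element of F_0, a
    scalar multiple of the monomial of its multidegree, is zero or has that
    monomial in I; this is what [str_augN] needs. *)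
Lemma resolves_strands F I : monomial_ideal I -> resolves F I zero_ideal ->
  exists e, strand_resolution F e (fun b => I 'X_[b]).
Proof.
move=> mI [hF ex [eps [deps Ieps surj ker]]].
have heps : homogeneous_mx (@bdeg _ _ F 0) (fun _ : 'I_1 => 0%MM) eps.
  by move=> j o m; rewrite (ord1 o) add0m => /deps.
have ker0 (v : 'rV_(rk F 0)) : v *m eps = 0 <-> exists w, v = w *m diff F 0.
  split=> [z|/ker z]; first by apply/ker; rewrite /zero_ideal z mxE.
  by apply/matrixP=> i j; rewrite !ord1 z mxE.
exists (strand_mx (@bdeg _ _ F 0) (fun _ : 'I_1 => 0%MM) eps); split.
- by move=> i; apply/low_strand_mx/homogeneous_diff.
- by move=> i b; apply: strand_exactness (ex i); apply: homogeneous_diff.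
- by move=> b; apply: strand_exactness ker0 => //; apply: homogeneous_diff.
- move=> b /surj [v /eqP]; rewrite subr_eq0 => /eqP eq.
  exists (strip (@bdeg _ _ F 0) b v); first exact: strip_below.
  rewrite -(strip_mul _ _ heps); apply/matrixP=> i j; rewrite !ord1 mxE -eq.
  have -> : (0 <= b)%MM by apply/mnm_lepP=> l; rewrite mnm0E.
  by rewrite subm0 mcoeffX eqxx mxE.
move=> j nz; apply: monomial_ideal_msupp mI (Ieps (delta_mx 0 j)) _.
rewrite mcoeff_msupp -rowE mxE; move: nz; rewrite mxE.
by rewrite (_ : bdeg j - 0 = bdeg j)%MM // subm0.
Qed.

Lemma diffk_modm F i : homogeneous F ->
  diffk F i = modm (@bdeg _ _ F i.+1) (@bdeg _ _ F i) (strand_diff F i).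
Proof.
move=> hF; apply/matrixP=> p q; rewrite !mxE.
case: (eqVneq (bdeg p) (bdeg q)) => [->|ne].
  have -> // : (bdeg q - bdeg q = 0)%MM.
  by apply/mnmP=> l; rewrite mnmBE mnm0E subnn.
apply/eqP; rewrite mulr0n mcoeff_eq0; apply/negP=> /hF; rewrite addm0 => eq.
by rewrite eq eqxx in ne.
Qed.

End TransferToStrands.

(** * Betti numbers and Euler characteristic of a resolution *)

Section Comparison.

Variables (k : fieldType) (n : nat).
Implicit Types (F G : mgseq k n) (P : 'X_{1..n} -> Prop).

(** Half of the comparison theorem: the composite F -> G -> F is homotopic to the
    identity, and this survives reduction modulo the maximal ideal, so the
    homology of the reduction of F embeds into that of G. *)
Lemma dim_homology_le F G eF eG P i a :
  homogeneous F -> homogeneous G ->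
  strand_resolution F eF P -> strand_resolution G eG P ->
  (dim_homology F i a <= dim_homology G i a)%N.
Proof.
move=> hF hG sF sG.
pose f i := comparison_map eF eG i; pose f' i := comparison_map eG eF i.
have lf i' : low (@bdeg _ _ F i') (@bdeg _ _ G i') (f i') by exact: comparison_map_low.
have lf' i' : low (@bdeg _ _ G i') (@bdeg _ _ F i') (f' i') by exact: comparison_map_low.
pose fb i : 'M_(rk F i, rk G i) := modm (@bdeg _ _ F i) (@bdeg _ _ G i) (f i).
pose fb' i : 'M_(rk G i, rk F i) := modm (@bdeg _ _ G i) (@bdeg _ _ F i) (f' i).
have fbd i' : fb i'.+1 *m diffk G i' = diffk F i' *m fb i'.
  rewrite !diffk_modm // /fb -(modm_mul (lf _) (str_low sG i')).
  rewrite (comparison_map_diff sF sG).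
  exact: modm_mul (str_low sF i') (lf i').
have fbd' i' : fb' i'.+1 *m diffk F i' = diffk G i' *m fb' i'.
  rewrite !diffk_modm // /fb' -(modm_mul (lf' _) (str_low sF i')).
  rewrite (comparison_map_diff sG sF).
  exact: modm_mul (str_low sG i') (lf' i').
have gd (H : mgseq k n) i' : homogeneous H ->
    gpart H i'.+1 a *m diffk H i' = diffk H i' *m gpart H i' a.
  by move=> hH; rewrite diffk_modm //; apply: modm_gpart.
have dd (H : mgseq k n) eH i' : homogeneous H -> strand_resolution H eH P ->
    diffk H i'.+1 *m diffk H i' = 0.
  move=> hH sH; rewrite !diffk_modm // -(modm_mul (str_low sH _) (str_low sH _)).
  by rewrite (strand_d2 _ sH) modm0.
apply: (@sub_quotient_dim k _ _ _ _ _ _ _ _ _ _ (fb i) (fb' i)).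
- rewrite sub_capmx {1}gd // submxMl /=.
  case: i => [|i]; first exact: submx1.
  by apply/sub_kermxP; rewrite -mulmxA (dd G eG) // mulmx0.
- rewrite sub_capmx; apply/andP; split.
    apply: submx_trans (submxMr _ (capmxSl _ _)) _.
    have -> : gpart F i a *m fb i = fb i *m gpart G i a by apply: modm_gpart.
    exact: submxMl.
  case: i => [|i]; first exact: submx1.
  apply/sub_kermxP; rewrite -mulmxA fbd mulmxA.
  suff -> : (gpart F i.+1 a :&: cycles F i.+1)%MS *m diffk F i = 0 by rewrite mul0mx.
  exact/sub_kermxP/capmxSr.
- rewrite -mulmxA -fbd' mulmxA.
  have -> : gpart G i.+1 a *m fb' i.+1 = fb' i.+1 *m gpart F i.+1 a.
    exact: modm_gpart.
  by rewrite -mulmxA submxMl.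
pose x i := f i *m f' i - 1%:M.
have lx i' : low (@bdeg _ _ F i') (@bdeg _ _ F i') (x i').
  by apply: low_sub; [apply: low_mul (lf i') (lf' i')|apply: low1].
have barx i' : modm (@bdeg _ _ F i') (@bdeg _ _ F i') (x i') = fb i' *m fb' i' - 1%:M.
  by rewrite modmB modm1 (modm_mul (lf i') (lf' i')).
have x0 : x 0%N *m eF = 0.
  rewrite mulmxBl mul1mx -mulmxA (comparison_map_aug sG sF).
  by rewrite (comparison_map_aug sF sG) subrr.
have xd i' : x i'.+1 *m strand_diff F i' = strand_diff F i' *m x i'.
  rewrite mulmxBl mulmxBr mul1mx mulmx1 -mulmxA (comparison_map_diff sG sF) mulmxA.
  by rewrite (comparison_map_diff sF sG) mulmxA.
have [[h lh eqh] hs] := null_homotopy sF lx x0 xd.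
rewrite -barx.
have Zg : (gpart F i a :&: cycles F i)%MS =
    (gpart F i a :&: cycles F i)%MS *m gpart F i a.
  by apply/esym/sub_coord_projP/capmxSl.
case: i Zg => [|i] Zg.
  rewrite Zg -mulmxA [X in _ *m X]modm_gpart eqh (modm_mul lh (str_low sF 0%N)).
  rewrite -diffk_modm // -!mulmxA -gd // !mulmxA -mulmxA submxMl //.
have [h1 [h2 [l1 l2 eq]]] := hs i.
rewrite eq modmD (modm_mul (str_low sF i) l1) (modm_mul l2 (str_low sF i.+1)).
rewrite mulmxDr mulmxA -!diffk_modm //.
have -> : (gpart F i.+1 a :&: cycles F i.+1)%MS *m diffk F i = 0.
  exact/sub_kermxP/capmxSr.
rewrite mul0mx add0r Zg -mulmxA [X in _ *m X]mulmxA.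
have -> : gpart F i.+1 a *m modm (@bdeg _ _ F i.+1) (@bdeg _ _ F i.+2) h2 =
          modm (@bdeg _ _ F i.+1) (@bdeg _ _ F i.+2) h2 *m gpart F i.+2 a.
  exact: modm_gpart.
by rewrite -[X in _ *m X]mulmxA mulmxA submxMl.
Qed.

Lemma dim_homology_minimal F i a : minimal F ->
  dim_homology F i a = #|[pred j | bdeg j == a :> 'X_{1..n}] : pred 'I_(rk F i)|.
Proof.
move=> mF; have d0 j : diffk F j = 0.
  by apply/matrixP=> p q; rewrite !mxE mF.
rewrite /dim_homology d0 mulmx0 mxrank0 subn0 -(rank_coord_proj k).
apply/eqmx_rank/andP; split; first exact: capmxSl.
rewrite sub_capmx submx_refl; case: i => [|i]; first exact: submx1.
by apply/sub_kermxP; rewrite d0 mulmx0.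
Qed.

Lemma betti_minimal_resolution (I : ideal k n) G i a :
  monomial_ideal I -> resolves G I zero_ideal -> minimal G ->
  betti I i a = #|[pred j | bdeg j == a :> 'X_{1..n}] : pred 'I_(rk G i)|.
Proof.
move=> mI rG mG; rewrite -dim_homology_minimal //.
have rF : resolves (free_resolution I) I zero_ideal.
  exact: (epsilon_spec (inhabits (@zero_mgseq k n))
    (fun F => resolves F I zero_ideal) (ex_intro _ G rG)).
have [[eF sF] [eG sG]] := (resolves_strands mI rF, resolves_strands mI rG).
have [[hF _ _] [hG _ _]] := (rF, rG).
apply/eqP; rewrite eqn_leq; apply/andP; split.
  exact: dim_homology_le sF sG.
exact: dim_homology_le sG sF.
Qed.

(** Euler characteristic of the strand of multidegree b: by exactness the
    alternating sum of dimensions telescopes to the rank of the augmentation. *)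
Lemma strand_euler F e P N b (c : bool) : strand_resolution F e P ->
  (forall m m', P m -> (m <= m')%MM -> P m') ->
  rk F N.+1 = 0%N -> (P b <-> c) ->
  \sum_(i < N.+1) (-1) ^+ i *
    #|[pred j | (bdeg j <= b)%MM] : pred 'I_(rk F i)|%:R = c%:R :> int.
Proof.
move=> sF upP rN Pc.
pose rho i := \rank (below k (@bdeg _ _ F i.+1) b *m strand_diff F i).
have rkS i : \rank (below k (@bdeg _ _ F i) b) =
    #|[pred j | (bdeg j <= b)%MM] : pred 'I_(rk F i)|.
  exact: rank_coord_proj.
have r0 : \rank (below k (@bdeg _ _ F 0) b) = (c + rho 0%N)%N.
  rewrite -(mxrank_mul_ker _ e) (str_exact0 sF); congr (_ + _)%N.
  case: c Pc => [[_ /(_ isT) /(str_aug sF) [v vb ve]]|[nP _]].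
    apply/eqP; rewrite eqn_leq rank_leq_col /=.
    rewrite -{1}(mxrank1 k 1) -ve; exact/mxrankS/submxMr.
  apply/eqP; rewrite mxrank_eq0; apply/eqP/matrixP=> i j.
  rewrite coord_proj_mulE !ord1 mxE.
  case: (boolP (bdeg i <= b)%MM) => [le|_]; last by rewrite mul0r.
  have [->|/(str_augN sF) Pi] := eqVneq (e i 0) 0; first by rewrite mulr0.
  by have := nP (upP _ _ Pi le).
have rS i : \rank (below k (@bdeg _ _ F i.+1) b) = (rho i + rho i.+1)%N.
  by rewrite -(mxrank_mul_ker _ (strand_diff F i)) (str_exact sF).
have main m : \sum_(i < m.+1) (-1) ^+ i *
    #|[pred j | (bdeg j <= b)%MM] : pred 'I_(rk F i)|%:R
    = c%:R + (-1) ^+ m * (rho m)%:R :> int.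
  elim: m => [|m IH].
    by rewrite big_ord1 -rkS r0 natrD expr0 !mul1r.
  rewrite big_ord_recr /= IH -rkS rS natrD mulrDr exprS.
  by rewrite -addrA mulN1r [X in _ + (_ + (X + _))]mulNr addNKr.
rewrite main (_ : rho N = 0%N) ?mulr0 ?addr0 //.
apply/eqP; rewrite -leqn0; apply: leq_trans (rank_leq_row _) _.
by rewrite rN.
Qed.

End Comparison.

(** * The Scarf resolution of the ideal *)

Section ScarfFaces.

Variables (n r : nat) (g : 'I_r -> 'X_{1..n}).
Implicit Types s t : {set 'I_r}.

(** Quantifying over nonempty t only makes a difference for the unit ideal, where
    the single generator has the lcm of the empty set: that generator is a face
    here, while the Scarf complex is void.  With this convention the nonempty
    faces index a minimal resolution of the ideal in all cases. *)
Definition nonempty_scarf : {set {set 'I_r}} :=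
  [set s | (s != set0) &&
     [forall t : {set 'I_r}, (t != set0) ==> (lcm_of g s == lcm_of g t) ==> (s == t)]].

Lemma nonempty_scarfP s :
  reflect (s != set0 /\ forall t, t != set0 -> lcm_of g s = lcm_of g t -> s = t)
    (s \in nonempty_scarf).
Proof.
rewrite inE; apply: (iffP andP) => [[s0 /forallP h]|[s0 h]]; split=> //.
  by move=> t t0 eq; apply/eqP; move: (h t); rewrite t0 eq eqxx.
apply/forallP=> t; apply/implyP=> t0; apply/implyP=> /eqP /(h t t0) ->; exact: eqxx.
Qed.

Lemma lcm_of0 : lcm_of g set0 = 0%MM.
Proof. by rewrite /lcm_of big_set0. Qed.

Lemma lcm_of1 i : lcm_of g [set i] = g i.
Proof. by rewrite /lcm_of big_set1E mlcm0. Qed.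

Lemma lcm_of_le s b : (lcm_of g s <= b)%MM = [forall i in s, (g i <= b)%MM].
Proof.
rewrite -big_andE /lcm_of; elim/big_rec2: _ => [|i y m _ <-].
  by apply/mnm_lepP=> i; rewrite mnm0E.
exact: lem_mlcm.
Qed.

Lemma scarf_facesS i : set0 \in scarf_complex g ->
  scarf_faces g i.+1 = [set s in nonempty_scarf | #|s| == i.+1].
Proof.
rewrite inE => /forallP h0; apply/setP=> s; rewrite !inE.
have [cs|] := boolP (#|s| == i.+1); rewrite ?andbF // !andbT.
have s0 : s != set0 by apply: contraTneq cs => ->; rewrite cards0.
rewrite s0; apply: eq_forallb => t; have [->|//] := eqVneq t set0.
rewrite (negbTE s0) implybF; apply/negP=> /eqP eq.
have := h0 s; rewrite eq eqxx /= eq_sym => /eqP e0.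
by rewrite e0 eqxx in s0.
Qed.

Lemma card_enum_val (T : finType) (A : {set T}) (p : pred T) :
  #|[pred j : 'I_#|A| | p (enum_val j)]| = #|[set s in A | p s]|.
Proof.
rewrite -(card_imset _ enum_val_inj); apply: eq_card => s; rewrite !inE.
apply/imsetP/andP=> [[j pj ->]|[sA ps]]; first by split; [apply: enum_valP|].
by exists (enum_rank_in sA s); rewrite ?inE enum_rankK_in.
Qed.

End ScarfFaces.

Section ScarfResolution.

Variables (k : fieldType) (n r : nat) (I : ideal k n) (g : 'I_r -> 'X_{1..n}).
Hypotheses (mI : monomial_ideal I) (gI : min_gens I g).

Lemma mem_idealX b : I 'X_[b] <-> exists i, (g i <= b)%MM.
Proof.
split=> [/min_gen_below [m /gI.2 [i ->] le]|[i]]; first by exists i.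
by apply: monomial_ideal_le => //; have [] := (gI.2 (g i)).2 (ex_intro _ i erefl).
Qed.

(** The multidegrees of the basis in homological degree i are those of the faces
    with i + 1 elements.  Counting them through an arbitrary predicate p serves
    both Betti numbers (p is equality with a) and Euler characteristics (p is
    divisibility of x^b). *)
Definition resolved_by_scarf_faces (G : mgseq k n) : Prop :=
  [/\ resolves G I zero_ideal, minimal G &
      forall i (p : pred 'X_{1..n}),
        #|[pred j : 'I_(rk G i) | p (bdeg j)]| =
        #|[set s in nonempty_scarf g | #|s| == i.+1 & p (lcm_of g s)]|].

(** When the empty set is a face, degree 0 of the Scarf complex is R, the
    augmentation to R / I is a nonzero scalar, and dropping it leaves a resolution
    of I, augmented by the old first differential. *)
Lemma shifted_scarf_resolution : set0 \in scarf_complex g ->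
  resolves (alg_scarf k g) unit_ideal I -> minimal (alg_scarf k g) ->
  resolved_by_scarf_faces
    (MgSeq (fun i => @bdeg _ _ (alg_scarf k g) i.+1)
           (fun i => diff (alg_scarf k g) i.+1)).
Proof.
move=> face0 [hF ex [eps [deps _ surj ker]]] mF.
set F := alg_scarf k g in hF ex eps deps surj ker mF *.
have e0 : scarf_faces g 0 = [set set0].
  apply/setP=> s; rewrite !inE cards_eq0.
  case: (eqVneq s set0) => [->|]; rewrite ?andbF // andbT.
  by rewrite inE in face0.
have r0 : rk F 0 = 1%N by rewrite /= e0 cards1.
have [j0 j0P] : exists j0 : 'I_(rk F 0), forall j, j = j0.
  have lt : (0 < rk F 0)%N by rewrite r0.
  exists (Ordinal lt) => j; apply/val_inj; have := ltn_ord j.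
  by rewrite [X in (_ < X)%N]r0 ltnS leqn0 => /eqP.
have degj j : bdeg (m := F) (i := 0) j = 0%MM.
  by have := enum_valP j; rewrite {2}e0 inE /= => /eqP ->; rewrite lcm_of0.
pose c := (eps j0 0)@_0.
have epsE : eps j0 0 = c%:MP.
  apply/mpolyP=> m; rewrite mcoeffC.
  case: (eqVneq m 0%MM) => [->|ne]; first by rewrite mulr1.
  rewrite mulr0; apply/eqP; rewrite mcoeff_eq0; apply/negP=> /deps eq.
  by move: ne; rewrite eq degj eqxx.
have mulE (v : 'rV_(rk F 0)) : (v *m eps) 0 0 = c *: v 0 j0.
  rewrite mxE (bigD1 j0) //= big1 ?addr0; last by move=> j; rewrite (j0P j) eqxx.
  by rewrite epsE mulrC mul_mpolyC.
have rowE0 (u v : 'rV_(rk F 0)) : u 0 j0 = v 0 j0 -> u = v.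
  by move=> eq; apply/rowP=> j; rewrite (j0P j).
have c0 : c != 0.
  apply/eqP=> z; have [v] := surj 1 Logic.I.
  rewrite mulE z scale0r subr0 -mpolyX0 => /mem_idealX [i le].
  have gi0 : g i = 0%MM.
    by apply: lepm_anti le _; apply/mnm_lepP=> l; rewrite mnm0E.
  move: face0; rewrite inE => /forallP /(_ [set i]).
  rewrite lcm_of0 lcm_of1 gi0 eqxx /= eq_sym => /eqP /setP /(_ i).
  by rewrite !inE eqxx.
split; last first.
- move=> i p /=; rewrite (card_enum_val _ (fun s => p (lcm_of g s))) scarf_facesS //.
  by apply: eq_card => s; rewrite !inE -andbA.
- by move=> i; apply: mF.
split; [by move=> i; apply: hF|by move=> i; apply: ex|].
exists (diff F 0 *m eps); split.
- move=> j m; rewrite mxE => /msupp_sum_le /flattenP [_ /mapP [q _ ->]].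
  move=> /msuppM_le /allpairsP [[e1 e2] /= [h1 h2 ->]].
  by rewrite (deps _ _ h2) addmC; apply: hF h1.
- by move=> v; rewrite mulmxA; apply/ker; exists v.
- move=> f If.
  have [v eq] : exists v, (\row_(q < rk F 0) (c^-1 *: f)) = v *m diff F 0.
    by apply/ker; rewrite mulE mxE scalerA divff // scale1r.
  exists v; rewrite /zero_ideal mulmxA -eq mulE mxE scalerA divff // scale1r.
  exact: subrr.
move=> v; rewrite mulmxA mulE /zero_ideal; split=> [/eqP|].
  rewrite scaler_eq0 (negbTE c0) /= => /eqP z; apply/ex/rowE0.
  by rewrite z mxE.
by move=> /(ex 0%N) ->; rewrite mxE scaler0.
Qed.

(** The empty set fails to be a face only if 1 is a generator; then I = R, which
    is free. *)
Lemma unit_ideal_resolution : set0 \notin scarf_complex g ->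
  exists G, resolved_by_scarf_faces G.
Proof.
rewrite inE negb_forall => /existsP [t]; rewrite negb_imply lcm_of0 eq_sym.
move=> /andP [/eqP lt t0].
have [i0 it] : exists i, i \in t by apply/set0Pn; rewrite eq_sym.
have I1 : I 'X_[0%MM].
  apply/mem_idealX; exists i0.
  by have := lepm_refl (lcm_of g t); rewrite {2}lt lcm_of_le => /forall_inP; apply.
have gi i : g i = 0%MM.
  have [_ gm] := (gI.2 (g i)).2 (ex_intro _ i erefl).
  by apply/esym/gm => //; apply/mnm_lepP=> l; rewrite mnm0E.
have i0P i : i = i0 by apply: gI.1; rewrite !gi.
have Iall f : I f.
  have [_ [H IH]] := mI; apply/IH; have /IH /mon_genX [m Hm le] := I1.
  exists [:: (m, f)]; split; first by move=> u; rewrite inE => /eqP ->.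
  have m0 : m = 0%MM by apply: lepm_anti le _; apply/mnm_lepP=> l; rewrite mnm0E.
  by rewrite big_seq1 /= m0 mpolyX0 mulr1.
pose G : mgseq k n :=
  MgSeq (rk := fun i => (i == 0)%N : nat) (fun _ _ => 0%MM) (fun=> 0).
have thin i (u v : 'rV[{mpoly k[n]}]_(rk G i.+1)) : u = v by apply/rowP=> -[].
exists G; split; last first.
- move=> i p.
  have scE s : s \in nonempty_scarf g = (s == [set i0]).
    have ne1 u : u != set0 -> u = [set i0].
      move=> /set0Pn [j ju]; apply/setP=> l; rewrite inE (i0P l) eqxx.
      by rewrite -(i0P j).
    apply/idP/eqP=> [/nonempty_scarfP [/ne1 //]|->]; apply/nonempty_scarfP; split.
      by apply/set0Pn; exists i0; rewrite inE.
    by move=> u /ne1 ->.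
  case: i => [|i]; last first.
    transitivity 0%N; first by apply: eq_card0 => -[m h].
    apply/esym/eq_card0 => s; rewrite inE scE.
    by case: eqP => // ->; rewrite cards1.
  have -> : [set s in nonempty_scarf g | #|s| == 1%N & p (lcm_of g s)] =
            if p 0%MM then [set [set i0]] else set0.
    apply/setP=> s; rewrite inE scE; case: eqP => [->|/eqP ne] /=.
      by rewrite cards1 lcm_of1 gi; case: (p _); rewrite inE ?eqxx.
    by case: (p _); rewrite inE ?(negbTE ne).
  have -> : #|[pred j : 'I_(rk G 0) | p (bdeg j)]| = #|[pred j : 'I_1 | p 0%MM]| by [].
  case: (p _); rewrite ?cards1 ?cards0; last exact: eq_card0.
  by rewrite -[RHS](card_ord 1); apply: eq_card.
- by move=> i u v; rewrite mxE mcoeff0.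
split.
- by move=> i u v m; rewrite mxE msupp0.
- by move=> i v; split=> [_|_]; [exists 0; apply: thin|rewrite mulmx0].
exists (const_mx 1); split.
- move=> j m; rewrite mxE msupp1 inE => /eqP -> //.
- by move=> v; apply: Iall.
- move=> f _; exists (const_mx f); rewrite /zero_ideal mxE big_ord1 !mxE mulr1.
  exact: subrr.
move=> v; rewrite /zero_ideal mxE big_ord1 !mxE mulr1; split=> [z|[w ->]].
  exists 0; apply/rowP=> j; rewrite mulmx0 (ord1 j) mxE -[RHS]z.
  by congr (v _ _); apply/val_inj.
by rewrite mulmx0 mxE.
Qed.

Lemma scarf_ideal_resolution :
  resolves (alg_scarf k g) unit_ideal I -> minimal (alg_scarf k g) ->
  exists G, resolved_by_scarf_faces G.
Proof.
move=> rF mF; have [f0|] := boolP (set0 \in scarf_complex g).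
  by exists (MgSeq (fun i => @bdeg _ _ (alg_scarf k g) i.+1)
    (fun i => diff (alg_scarf k g) i.+1)); apply: shifted_scarf_resolution.
exact: unit_ideal_resolution.
Qed.

Lemma betti_scarf G i a : resolved_by_scarf_faces G ->
  betti I i a = #|[set s in nonempty_scarf g | #|s| == i.+1 & lcm_of g s == a]|.
Proof.
case=> rG mG cG; rewrite (betti_minimal_resolution _ _ mI rG mG).
exact: (cG i (pred1 a)).
Qed.

Lemma euler_scarf G b : resolved_by_scarf_faces G ->
  \sum_(s in nonempty_scarf g | (lcm_of g s <= b)%MM) (-1) ^+ #|s|.-1
  = [exists i, (g i <= b)%MM]%:R :> int.
Proof.
case=> rG mG cG; have [e sG] := resolves_strands mI rG.
have cr i : rk G i = #|[set s in nonempty_scarf g | #|s| == i.+1]|.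
  rewrite -[LHS]card_ord; have := cG i predT; rewrite /= => ->.
  by apply: eq_card => s; rewrite !inE andbT.
have rN : rk G r.+1 = 0%N.
  rewrite cr; apply: eq_card0 => s; rewrite !inE; apply/negP=> /andP [_ /eqP eq].
  by have := max_card (mem s); rewrite eq card_ord ltnNge leqnSn.
have memb : I 'X_[b] <-> [exists i, (g i <= b)%MM].
  split=> [/mem_idealX [i le]|/existsP h]; last exact/mem_idealX.
  by apply/existsP; exists i.
rewrite -(strand_euler sG (fun m m' => @monomial_ideal_le _ _ I m m' mI) rN memb).
rewrite (partition_big (fun s : {set 'I_r} => inord #|s|.-1 : 'I_r.+1) predT) //=.
apply: eq_bigr => i _; rewrite (cG i (fun m => (m <= b)%MM)).
have idx s : s \in nonempty_scarf g -> (inord #|s|.-1 == i) = (#|s| == i.+1).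
  move=> /nonempty_scarfP [s0 _]; move: s0; rewrite -card_gt0 => s0.
  rewrite -val_eqE /= inordK; first by rewrite -eqSS prednK.
  rewrite prednK //.
  by have := max_card (mem s); rewrite card_ord => /leq_trans; apply; apply: leqnSn.
rewrite -sum1_card natr_sum mulr_sumr.
apply: eq_big => [s|s].
  rewrite [RHS]inE; case: (boolP (s \in _)) => //= sN.
  by rewrite idx // andbC.
by move=> /andP [/andP [sN _]]; rewrite idx // => /eqP ->; rewrite mulr1.
Qed.

End ScarfResolution.

(** * Signed counts by multidegree *)

Section Moebius.

Variables (n : nat) (T : finType) (m : T -> 'X_{1..n}) (w : T -> int).

(** Group the terms by their value under m, each class being represented by a
    chosen element of T. *)
Lemma sum_by_degree (P : pred 'X_{1..n}) :
  (forall a, P a -> \sum_(t | m t == a) w t = 0) -> \sum_(t | P (m t)) w t = 0.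
Proof.
move=> h; pose c t := odflt t [pick s | m s == m t].
have mc t : m (c t) = m t by rewrite /c; case: pickP => [s /eqP|].
have cm s t : m s = m t -> c s = c t.
  move=> eq; rewrite /c; have -> : [pick u | m u == m s] = [pick u | m u == m t].
    by apply: eq_pick => u; rewrite eq.
  by case: pickP => //= /(_ t); rewrite eqxx.
rewrite (partition_big c predT) //= big1 // => j _.
have [/andP [Pj /eqP cj]|nj] := boolP (P (m j) && (c j == j)).
  rewrite -[RHS](h _ Pj); apply: eq_bigl => t.
  apply/andP/eqP=> [[_ /eqP <-]|eq]; first by rewrite mc.
  by rewrite eq Pj (cm _ _ eq) cj.
apply: big_pred0 => t; apply: contraNF nj => /andP [Pt /eqP <-].
by rewrite mc Pt (cm _ t (mc t)) eqxx.
Qed.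

(** Summation over divisors is unitriangular, hence injective: by induction on
    the degree of a, all classes strictly below a contribute zero. *)
Lemma moebius_degree :
  (forall b, \sum_(t | (m t <= b)%MM) w t = 0) ->
  forall a, \sum_(t | m t == a) w t = 0.
Proof.
move=> h a; have [N] := ubnP (mdeg a); elim: N a => // N IH a; rewrite ltnS => lt.
have /eqP := h a; rewrite (bigID (fun t => m t == a)) /=.
rewrite [X in _ + X](@sum_by_degree (fun x => (x <= a)%MM && (x != a))); last first.
  move=> x /andP [le ne]; apply: IH; apply: leq_trans lt.
  rewrite -(submK le) mdegD -[X in (X < _)%N]add0n ltn_add2r lt0n mdeg_eq0.
  by apply: contraNN ne => /eqP z; rewrite -(submK le) z add0m.
rewrite addr0 => /eqP e; rewrite -[RHS]e; apply: eq_bigl => t.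
by case: eqP => [->|]; rewrite ?lepm_refl ?andbF.
Qed.

End Moebius.

(** * Minimal elements for divisibility *)

Section Minimals.

Variables (n : nat) (T : eqType) (f : T -> 'X_{1..n}).

(** Elements with equal value are identified as well: one of them is kept, so the
    values of the result are the minimal generators without repetition. *)
Fixpoint minimals (s : seq T) : seq T :=
  if s is i :: s' then
    let p := minimals s' in
    if has (fun j => (f j <= f i)%MM) p then p
    else i :: [seq j <- p | ~~ (f i <= f j)%MM]
  else [::].

Lemma minimals_subseq s : subseq (minimals s) s.
Proof.
elim: s => //= i s IH; case: ifP => _.
  exact: subseq_trans IH (subseq_cons _ _).
by rewrite eqxx; apply: subseq_trans (filter_subseq _ _) IH.
Qed.

Lemma minimals_antichain s i j :
  i \in minimals s -> j \in minimals s -> (f i <= f j)%MM -> i = j.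
Proof.
elim: s i j => //= x s IH i j; case: ifP => [_|/hasPn h]; first exact: IH.
rewrite !inE !mem_filter => /orP [/eqP ->|/andP [xi ip]] /orP [/eqP ->|/andP [xj jp]] //.
- by rewrite (negbTE xj).
- by rewrite (negbTE (h _ ip)).
exact: IH.
Qed.

Lemma minimals_cover s i : i \in s ->
  exists2 j, j \in minimals s & (f j <= f i)%MM.
Proof.
elim: s i => //= x s IH i; rewrite inE; case: ifP => [/hasP [j jp le]|_] /orP [/eqP ->|].
- by exists j.
- exact: IH.
- by exists x; rewrite ?inE ?eqxx ?lepm_refl.
move=> /IH [j jp le]; case: (boolP (f x <= f j)%MM) => [le'|nle].
  by exists x; rewrite ?inE ?eqxx // (lepm_trans le' le).
by exists j => //; rewrite inE mem_filter nle jp orbT.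
Qed.

End Minimals.

(** * Labelled nodes of the tree *)

Section Tree.

Variables (n r : nat) (g : 'I_r -> 'X_{1..n}).
Implicit Types (C s t : {set 'I_r}) (S : seq 'I_r).

Definition label_lcm C i := lcm_of g (i |: C).

(** The generators of the left child are the lcms of the pivot, labelled C + i,
    with the other generators. *)
Lemma label_lcm_le C i j b :
  (label_lcm (i |: C) j <= b)%MM = (label_lcm C j <= b)%MM && (label_lcm C i <= b)%MM.
Proof.
rewrite !lcm_of_le; apply/forall_inP/andP=> [h|[/forall_inP h1 /forall_inP h2] l].
  split; apply/forall_inP=> l /setU1P lC; apply: h; rewrite !inE;
  by case: lC => [->|->]; rewrite ?eqxx ?orbT.
rewrite !inE => /orP [lj|lC]; first by apply: h1; rewrite !inE lj.
by apply: h2; rewrite !inE.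
Qed.

(** The pair (C, S) stands for the node whose minimal generators have the labels
    C + i, for i in S. *)
Definition state := ({set 'I_r} * seq 'I_r)%type.

(** Descent to a child: right when b is true, left when b is false. *)
Definition step (b : bool) (st : state) : option state :=
  if st.2 is i :: S' then
    if nilp S' then None
    else Some (if b then (st.1, S')
               else (i |: st.1, minimals (label_lcm (i |: st.1)) S'))
  else None.

Fixpoint state_at (st : state) (p : seq bool) : option state :=
  if p is b :: p' then obind (state_at^~ p') (step b st) else Some st.

Lemma state_at_rcons st p b :
  state_at st (rcons p b) = obind (step b) (state_at st p).
Proof.
elim: p st => [|c p IH] st /=; first by case: (step b st).
by case: (step c st).
Qed.

Lemma minimals_disjoint C i S : i \notin S -> uniq S ->
  {in i :: S, forall j, j \notin C} ->
  uniq (minimals (label_lcm (i |: C)) S) /\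
  {in minimals (label_lcm (i |: C)) S, forall j, j \notin i |: C}.
Proof.
move=> iS uS dC; split; first exact: subseq_uniq (minimals_subseq _ _) uS.
move=> j /(mem_subseq (minimals_subseq _ _)) jS.
rewrite !inE negb_or dC ?inE ?jS ?orbT // andbT.
by apply: contraNneq iS => <-.
Qed.

Definition good_state (st : state) : Prop :=
  [/\ uniq st.2, st.2 != [::], {in st.2, forall i, i \notin st.1} &
      {in st.2 &, forall i j, (label_lcm st.1 i <= label_lcm st.1 j)%MM -> i = j}].

Lemma step_invariants b st st' : good_state st -> step b st = Some st' ->
  [/\ good_state st', st.1 \subset st'.1, st'.1 \subset st.1 :|: [set i in st.2],
      {subset st'.2 <= behead st.2} & #|st'.1| = (#|st.1| + ~~ b)%N].
Proof.
case: st => C [|i S] //; rewrite /good_state /step /=.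
case: nilP => // /eqP S0 [/andP [iS uS] _ dC anti] [<-].
have iC : i \notin C by apply: dC; rewrite inE eqxx.
case: b => /=; split=> //.
- split=> // [x xS|x y xS yS]; first by apply: dC; rewrite inE xS orbT.
  by apply: anti; rewrite inE ?xS ?yS orbT.
- exact: subsetUl.
- by rewrite addn0.
- have [uM dM] := minimals_disjoint iS uS dC; split=> //.
  + case: S S0 {iS uS dC anti uM dM} => // j S _; apply/eqP=> e.
    have jS : j \in j :: S by rewrite inE eqxx.
    by have [l] := minimals_cover (label_lcm (i |: C)) jS; rewrite e.
  by move=> x y; apply: minimals_antichain.
- exact: subsetUr.
- by apply/subsetP=> x; rewrite !inE => /orP [->|->]; rewrite ?orbT.
- exact/mem_subseq/minimals_subseq.
by rewrite cardsU1 iC addnC.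
Qed.

Lemma state_at_invariants p st st' : good_state st -> state_at st p = Some st' ->
  [/\ good_state st', st.1 \subset st'.1, st'.1 \subset st.1 :|: [set i in st.2],
      {subset st'.2 <= st.2} & #|st'.1| = (#|st.1| + count negb p)%N].
Proof.
elim: p st => [|b p IH] st gst /=; first by case=> <-; split; rewrite ?addn0 ?subsetUl.
case E: (step b st) => [st1|] //= /IH.
have [g1 s1 s2 s3 c1] := step_invariants gst E.
case=> // g' s1' s2' s3' c'; split=> //.
- exact: subset_trans s1 s1'.
- apply: subset_trans s2' _; rewrite subUset s2 /=; apply/subsetP=> x.
  by rewrite !inE => /s3 /mem_behead ->; rewrite orbT.
- by move=> x /s3' /s3 /mem_behead.
by rewrite c' c1 addnA.
Qed.

(** The last turn is a left turn, or there is none: with the bits of a path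
    appended to a leading 1, these are the positions 1 and the even ones. *)
Definition relpath (p : seq bool) := ~~ last false p.

Lemma relpath_behead b p : relpath (b :: p) -> relpath p.
Proof. by case: p. Qed.

Definition occurs st p s : Prop :=
  relpath p /\ exists C S i, [/\ state_at st p = Some (C, S), i \in S & s = i |: C].

(** Compare two paths at their first difference.  If they part, the pivot lies in
    the label reached through the left child and can no longer enter a label in
    the right subtree.  If one path stops, the label has one element more than C
    there, which forbids any later left turn, and a relevant path ends with a left
    turn. *)
Lemma occurs_unique p q st s : good_state st -> occurs st p s -> occurs st q s -> p = q.
Proof.
have card_occ st' p' C S i : good_state st' -> state_at st' p' = Some (C, S) -> i \in S ->
    #|i |: C| = (#|st'.1| + count negb p').+1.
  move=> gst /(state_at_invariants gst) [[_ _ dC _] _ _ _ /= <-] /dC iC.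
  by rewrite cardsU1 iC.
have nilcase st' q' : good_state st' -> occurs st' [::] s -> occurs st' q' s -> [::] = q'.
  move=> gst [_ [C [S [i [eC iS ->]]]]] [rq [C' [S' [i' [eC' iS' eq]]]]].
  have := card_occ _ _ _ _ _ gst eC iS; rewrite eq (card_occ _ _ _ _ _ gst eC' iS').
  move=> [/eqP]; rewrite eqn_add2l /= -leqn0 leqNgt -has_count => /hasPn h.
  case/lastP: q' rq {eC'} h => // q' b; rewrite /relpath last_rcons => nb /(_ b).
  by rewrite mem_rcons inE eqxx nb => /(_ isT).
elim: p q st => [|b p IH] [|c q] st gst //; first exact: nilcase.
  by move=> o1 o2; apply/esym; apply: nilcase gst o2 o1.
move=> [rp [C [S [i [/= eC iS es]]]]] [rq [C' [S' [i' [/= eC' iS' es']]]]].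
case E: (step b st) eC => [st1|] //= eC; case E': (step c st) eC' => [st1'|] //= eC'.
have [g1 _ _ _ _] := step_invariants gst E; have [g1' _ _ _ _] := step_invariants gst E'.
have [eqbc|nbc] := eqVneq b c.
  rewrite -eqbc; congr (_ :: _); apply: (IH _ st1) => //.
    by split; [apply: relpath_behead rp|exists C, S, i].
  split; first exact: relpath_behead rq.
  by exists C', S', i'; split=> //; move: E'; rewrite -eqbc E => -[->].
have clash p1 p2 st' st'' D D' U U' j j' : step false st = Some st' ->
    step true st = Some st'' -> state_at st' p1 = Some (D, U) ->
    state_at st'' p2 = Some (D', U') -> j' \in U' -> j |: D = j' |: D' -> False.
  move=> e1 e2 f1 f2 jU eq.
  have [h1 _ _ _ _] := step_invariants gst e1.
  have [h2 _ _ _ _] := step_invariants gst e2.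
  have [_ sub1 _ _ _] := state_at_invariants h1 f1.
  have [_ _ sub2 sub3 _] := state_at_invariants h2 f2.
  case: st gst e1 e2 {E E'} => K [|x [|y V]] // [/= /andP [xV _] _ dK _] [E1] [E2].
  have xC : x \in j' |: D'.
    by rewrite -eq in_setU1 (subsetP sub1) ?orbT // -E1 in_setU1 eqxx.
  have xK : x \notin K by apply: dK; rewrite inE eqxx.
  move: xC; rewrite in_setU1 => /orP [/eqP ex|/(subsetP sub2)].
    by move: (sub3 _ jU); rewrite -ex -E2 /= (negbTE xV).
  by rewrite -E2 in_setU in_set /= (negbTE xV) (negbTE xK).
case: b c nbc E E' {rp rq IH} => -[] // _ E E'.
  by case: (clash _ _ _ _ _ _ _ _ _ _ E' E eC' eC iS (etrans (esym es') es)).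
by case: (clash _ _ _ _ _ _ _ _ _ _ E E' eC eC' iS' (etrans (esym es) es')).
Qed.

(** All labels at relevant nodes below (C, S), root included.  The list of the
    right child treats it as relevant, and so already contains the labels of
    the generators that the root shares with it; the root adds only the label of
    its pivot.  N bounds the recursion and is enough when it is at least the
    size of S. *)
Fixpoint labels N C S : seq {set 'I_r} :=
  if N is N'.+1 then
    if S is i :: S' then
      (i |: C) :: labels N' (i |: C) (minimals (label_lcm (i |: C)) S') ++ labels N' C S'
    else [::]
  else [::].

Lemma size_minimals (f : 'I_r -> 'X_{1..n}) S : (size (minimals f S) <= size S)%N.
Proof. exact/size_subseq/minimals_subseq. Qed.

Lemma labels_bounds N C S s : s \in labels N C S ->
  [/\ C \subset s, s \subset C :|: [set i in S] & exists2 i, i \in S & i \in s].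
Proof.
elim: N C S => // N IH C [|i S] //=; rewrite inE mem_cat => /or3P [/eqP ->|/IH|/IH].
- split; first exact: subsetUr.
    by apply/subsetP=> x; rewrite !inE => /orP [->|->]; rewrite ?orbT.
  by exists i; rewrite !inE eqxx.
- move=> [s1 s2 [j js jC]]; split; first exact: subset_trans (subsetUr _ _) s1.
    apply: subset_trans s2 _; apply/subsetP=> x; rewrite !inE -orbA.
    move=> /or3P [->|->|/(mem_subseq (minimals_subseq _ _)) ->]; rewrite ?orbT //.
  exists i; first by rewrite inE eqxx.
  by apply: (subsetP s1); rewrite !inE eqxx.
move=> [s1 s2 [j js jC]]; split=> //.
  apply: subset_trans s2 _; apply/subsetP=> x; rewrite !inE.
  by move=> /orP [->|->]; rewrite ?orbT.
by exists j; rewrite // inE js orbT.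
Qed.

(** The three parts of the list are told apart by the pivot i: labels from the
    right subtree avoid it, labels from the left one contain it together with
    another index outside C. *)
Lemma uniq_labels N C S : uniq S -> {in S, forall i, i \notin C} ->
  uniq (labels N C S).
Proof.
elim: N C S => // N IH C [|i S] //= /andP [iS uS] dC.
have iC : i \notin C by apply: dC; rewrite inE eqxx.
have [uL dL] := minimals_disjoint iS uS dC.
have notR s : s \in labels N C S -> i \notin s.
  move=> /labels_bounds [_ /subsetP h _]; apply: contraNN iS => /h.
  by rewrite !inE (negbTE iC).
rewrite mem_cat negb_or cat_uniq !IH //; last first.
  by move=> x xS; apply: dC; rewrite inE xS orbT.
rewrite andbT /= -andbA; apply/and3P; split.
- by apply/negP=> /labels_bounds [_ _ [j /dL /negP]].
- by apply/negP=> /notR; rewrite !inE eqxx.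
apply/hasPn=> s /notR; apply: contraNN => /labels_bounds [/subsetP h _ _].
by apply: h; rewrite !inE eqxx.
Qed.

Lemma occurs_nil C p s : ~ occurs (C, [::]) p s.
Proof. by case: p => [|b p] [_ [C' [S' [i []]]]] // [<- <-]. Qed.

Lemma labels_occurs N C S s : (size S <= N)%N ->
  s \in labels N C S <-> exists p, occurs (C, S) p s.
Proof.
elim: N C S s => [|N IH] C [|i S] s //=.
- by move=> _; split=> // -[p /occurs_nil].
- by move=> _; split=> // -[p /occurs_nil].
rewrite ltnS => le; have leL := leq_trans (size_minimals (label_lcm (i |: C)) S) le.
rewrite inE mem_cat; split.
  move=> /or3P [/eqP ->|/(IH _ _ _ leL) [p [rp [C' [S' [x [eq xS ->]]]]]]|].
  - by exists [::]; split=> //; exists C, (i :: S), i; rewrite inE eqxx.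
  - case: S {IH le leL} eq => [|j S] eq.
      by case: p eq {rp} => //= -[_ e]; rewrite -e in xS.
    exists (false :: p); split; first by case: p rp {eq}.
    by exists C', S', x.
  move=> /(IH _ _ _ le) [p [rp [C' [S' [x [eq xS ->]]]]]].
  case: p eq rp => [|b p] eq rp.
    case: eq xS => <- <- xS; exists [::]; split=> //; exists C, (i :: S), x.
    by rewrite inE xS orbT.
  exists (true :: b :: p); split=> //; exists C', S', x; split=> //.
  by case: S eq {IH le leL}.
case=> -[|b p] [rp [C' [S' [x [eq xS ->]]]]].
  case: eq xS => <- <-; rewrite inE => /orP [/eqP ->|xS]; first by rewrite eqxx.
  apply/or3P/Or33; apply: (IH _ _ _ le).2; exists [::]; split=> //; by exists C, S, x.
have rp' := relpath_behead rp.
case: S le leL eq => [|j S] // le leL; case: b rp => rp /= eq.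
  by apply/or3P/Or33; apply: (IH _ _ _ le).2; exists p; split=> //; exists C', S', x.
by apply/or3P/Or32; apply: (IH _ _ _ leL).2; exists p; split=> //; exists C', S', x.
Qed.

Lemma le_lcm_of s i : i \in s -> (g i <= lcm_of g s)%MM.
Proof.
move=> si; have := lepm_refl (lcm_of g s).
by rewrite {1}lcm_of_le => /forall_inP; apply.
Qed.

Lemma lcm_of_mono s t : s \subset t -> (lcm_of g s <= lcm_of g t)%MM.
Proof.
move=> /subsetP st; rewrite lcm_of_le; apply/forall_inP=> i /st.
exact: le_lcm_of.
Qed.

(** The descent follows s: right when the pivot is not in s, left otherwise.
    The point is that an index x of s never becomes redundant in a left child. *)
Lemma scarf_labels N C S s : (size S <= N)%N -> s \in nonempty_scarf g ->
  uniq S -> {in S, forall i, i \notin C} ->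
  C \proper s -> s \subset C :|: [set i in S] -> s \in labels N C S.
Proof.
move=> + /nonempty_scarfP [s0 scarf].
have noS (D : {set 'I_r}) : ~ (D \proper s /\ s \subset D :|: [set i in [::]]).
  case=> /properP [_ [x xs xC]] /subsetP /(_ x xs).
  by rewrite !inE (negbTE xC).
elim: N C S => [|N IH] C [|i S] //=; rewrite ?ltnS.
- by move=> _ _ _ pr sub; case: (noS C).
- by move=> _ _ _ pr sub; case: (noS C).
move=> le /andP [iS uS] dC pr /subsetP sub; rewrite inE mem_cat.
have [is_|nis] := boolP (i \in s); last first.
  apply/or3P/Or33/IH => //; first by move=> x xS; apply: dC; rewrite inE xS orbT.
  apply/subsetP=> x xs; have := sub x xs.
  by rewrite !inE; case: (eqVneq x i) => [xi|//]; rewrite -xi xs in nis.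
have [//|ne] := eqVneq s (i |: C); rewrite orFb; apply/orP; left.
have [uM dM] := minimals_disjoint iS uS dC.
have iCs : i |: C \subset s.
  by rewrite subUset sub1set is_ (proper_sub pr).
apply: IH => //.
- exact: leq_trans (size_minimals _ _) le.
- by rewrite properEneq eq_sym ne.
apply/subsetP=> x xs; have := sub x xs; rewrite !inE -orbA.
case/or3P=> [->|->|xS]; rewrite ?orbT //.
apply/or3P/Or33.
have [y yM le'] := minimals_cover (label_lcm (i |: C)) xS.
suff <- : y = x by [].
(* If y is not x, then m_y divides the lcm of s - y, and both s + y and s - y have
   the lcm of s, which a Scarf face excludes. *)
have subx : x |: (i |: C) \subset s by rewrite subUset sub1set xs.
have gy : (g y <= label_lcm (i |: C) x)%MM.
  by apply: lepm_trans le'; apply: le_lcm_of; rewrite !inE eqxx.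
have ys : y \in s.
  suff -> : s = y |: s by rewrite !inE eqxx.
  apply: scarf; first by apply/set0Pn; exists y; rewrite !inE eqxx.
  apply: lepm_anti; first exact/lcm_of_mono/subsetUr.
  rewrite lcm_of_le; apply/forall_inP=> z; rewrite inE => /orP [/set1P ->|].
    exact: lepm_trans gy (lcm_of_mono subx).
  exact: le_lcm_of.
apply/eqP/negPn/negP=> nyx.
suff e : s = s :\ y by move: ys; rewrite e !inE eqxx.
have xsy : x \in s :\ y by rewrite !inE eq_sym nyx.
apply: scarf; first by apply/set0Pn; exists x.
apply: lepm_anti; last exact/lcm_of_mono/subsetDl.
rewrite lcm_of_le; apply/forall_inP=> z zs; have [->|zy] := eqVneq z y; last first.
  by apply: le_lcm_of; rewrite !inE zy.
apply: lepm_trans gy _; apply: lcm_of_mono.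
by rewrite subUset sub1set xsy subsetD1 iCs dM.
Qed.

Definition covers C S b := has (fun i => (label_lcm C i <= b)%MM) S.

Lemma covers_minimals C i S b :
  covers (i |: C) (minimals (label_lcm (i |: C)) S) b =
  (label_lcm C i <= b)%MM && covers C S b.
Proof.
apply/hasP/andP=> [[j /(mem_subseq (minimals_subseq _ _)) jS]|[lei /hasP [j jS lej]]].
  by rewrite label_lcm_le => /andP [lej ->]; split=> //; apply/hasP; exists j.
have [y yM ley] := minimals_cover (label_lcm (i |: C)) jS; exists y => //.
by apply: lepm_trans ley _; rewrite label_lcm_le lej.
Qed.
(** With J = R + (m) for the pivot m and right child R, the left child is the
    intersection of R and (m), so the indicators satisfy
    [J] = [m] + [R] - [left child]; labels of the left child have one more
    element in C, which accounts for the sign. *)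
Lemma labels_euler N C S b : (size S <= N)%N ->
  uniq S -> {in S, forall i, i \notin C} ->
  \sum_(s <- labels N C S | (lcm_of g s <= b)%MM) (-1) ^+ #|s|
  = (-1) ^+ #|C|.+1 * (covers C S b)%:R :> int.
Proof.
elim: N C S => [|N IH] C [|i S] //=; rewrite ?big_nil ?mulr0 ?ltnS //.
move=> le /andP [iS uS] dC.
have [uM dM] := minimals_disjoint iS uS dC.
have iC : i \notin C by apply: dC; rewrite inE eqxx.
rewrite big_cons big_cat /= !IH //; last 2 first.
- by move=> x xS; apply: dC; rewrite inE xS orbT.
- exact: leq_trans (size_minimals _ _) le.
rewrite covers_minimals cardsU1 iC add1n -/(label_lcm C i) -/(covers C S b).
rewrite !exprS; case: (label_lcm C i <= b)%MM => /=; case: (covers C S b) => /=;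
by rewrite ?mulr1 ?mulr0 ?addr0 ?add0r ?mulN1r ?opprK ?addKr ?addNKr.
Qed.

End Tree.

(** * The labelled nodes are the nodes of a Mayer-Vietoris tree *)

Section Nodes.

Variables (k : fieldType) (n r : nat) (g : 'I_r -> 'X_{1..n}).
Implicit Types (C s : {set 'I_r}) (S : seq 'I_r) (J : ideal k n).

(** Comparing monomials only is enough, because minimal generators depend on
    nothing else. *)
Definition represents J (st : state r) : Prop :=
  forall b, J 'X_[b] <-> covers g st.1 st.2 b.

Lemma represents_min_gen J C S m : good_state g (C, S) -> represents J (C, S) ->
  min_gen J m <-> exists2 i, i \in S & m = label_lcm g C i.
Proof.
move=> [_ _ _ /= anti] rJ; split=> [[Jm mm]|[i iS ->]].
  have /rJ /hasP [i iS le] := Jm; exists i => //.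
  by apply/esym/mm => //; apply/rJ/hasP; exists i => //; apply: lepm_refl.
split=> [|m' /rJ /hasP [j jS le] le'].
  by apply/rJ/hasP; exists i => //; apply: lepm_refl.
have eq := anti j i jS iS (lepm_trans le le'); rewrite eq in le.
exact: lepm_anti.
Qed.

Lemma represents_right J C i S : good_state g (C, i :: S) -> represents J (C, i :: S) ->
  represents (right_child J (label_lcm g C i)) (C, S).
Proof.
move=> gst rJ b; have [/= /andP [iS _] _ _ anti] := gst.
split=> [/mon_genX [m [/(represents_min_gen _ gst rJ) [j jS ->] ne] le]|/hasP [j jS le]].
  apply/hasP; exists j => //; move: jS; rewrite inE => /orP [/eqP e|//].
  by case: ne; rewrite e.
apply/mon_genX; exists (label_lcm g C j) => //; split.
  by apply/(represents_min_gen _ gst rJ); exists j => //; rewrite inE jS orbT.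
move=> e; have ij : i = j.
  by apply: anti; rewrite ?inE ?eqxx ?jS ?orbT // e lepm_refl.
by rewrite ij jS in iS.
Qed.

Lemma represents_left J C i S : good_state g (C, i :: S) -> represents J (C, i :: S) ->
  represents (left_child J (label_lcm g C i)) (i |: C, minimals (label_lcm g (i |: C)) S).
Proof.
move=> gst rJ b; rewrite covers_minimals; have rR := represents_right gst rJ b.
split=> [[/rR cS /mon_genX [m -> le]]|/andP [le cS]]; first by rewrite le.
by split; [apply/rR|apply/mon_genX; exists (label_lcm g C i)].
Qed.

(** The pivot is the first generator of the list. *)
Fixpoint pivot_tree N C S : mvtree n :=
  if N is N'.+1 then
    if S is i :: S' then
      if nilp S' then MVLeaf n
      else MVNode (label_lcm g C i)
             (pivot_tree N' (i |: C) (minimals (label_lcm g (i |: C)) S'))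
             (pivot_tree N' C S')
    else MVLeaf n
  else MVLeaf n.

(** Positions are read off paths in binary, after a leading 1. *)
Definition pos (p : seq bool) : nat := foldl (fun q (b : bool) => 2 * q + b)%N 1%N p.

Lemma pos_rcons p b : pos (rcons p b) = (2 * pos p + b)%N.
Proof. by rewrite /pos foldl_rcons. Qed.

Lemma pos_gt0 p : (0 < pos p)%N.
Proof.
by case/lastP: p => [//|p b]; elim/last_ind: p b => [|p c IH] b;
  rewrite pos_rcons addn_gt0 muln_gt0 // IH.
Qed.

Lemma pos_inj : injective pos.
Proof.
elim/last_ind=> [|p b IH] q; case/lastP: q => [//|q c]; rewrite ?pos_rcons.
- by have := pos_gt0 q; case: (pos q) => // x _; rewrite mulnS.
- by have := pos_gt0 p; case: (pos p) => // x _; rewrite mulnS.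
move=> eq; have ebc : b = c.
  by move: (congr1 odd eq); rewrite !mul2n !oddD !odd_double !oddb.
move: eq; rewrite ebc => /addIn /eqP; rewrite eqn_mul2l /= => /eqP /IH ->.
by [].
Qed.

Lemma relevant_pos p : relevant (pos p) = relpath p.
Proof.
case/lastP: p => [//|p b]; rewrite /relevant /relpath last_rcons pos_rcons.
rewrite mul2n oddD odd_double oddb; have := pos_gt0 p; case: (pos p) => // x _.
Qed.

Section Root.

Variables (I : ideal k n) (st0 : state r).
Hypotheses (g0 : good_state g st0) (rI : represents I st0).

Let T := pivot_tree (size st0.2) st0.1 st0.2.

Lemma node_state p d J t : mv_node I T p d J t ->
  exists q N C S, [/\ state_at g st0 q = Some (C, S), p = pos q, d = count negb q,
    represents J (C, S) & t = pivot_tree N C S /\ (size S <= N)%N].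
Proof.
elim=> [|{p d J}p d J m tl tr _ IH|{p d J}p d J m tl tr _ IH].
- exists [::], (size st0.2), st0.1, st0.2; split=> //.
  by case: st0.
- have [q [N [C [S [eq -> -> rJ []]]]]] := IH.
  case: N => // N; case: S eq rJ => //= i S eq rJ; case E: (nilp S) => // -[-> -> _].
  rewrite ltnS => le; have [gst _ _ _ _] := state_at_invariants g0 eq.
  exists (rcons q false), N, (i |: C), (minimals (label_lcm g (i |: C)) S); split.
  + by rewrite state_at_rcons eq /= /step /= E.
  + by rewrite pos_rcons addn0.
  + by rewrite -cats1 count_cat addn1.
  + exact: represents_left.
  by split=> //; apply: leq_trans (size_minimals _ _) le.
have [q [N [C [S [eq -> -> rJ []]]]]] := IH.
case: N => // N; case: S eq rJ => //= i S eq rJ; case E: (nilp S) => // -[-> _ ->].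
rewrite ltnS => le; have [gst _ _ _ _] := state_at_invariants g0 eq.
exists (rcons q true), N, C, S; split=> //.
+ by rewrite state_at_rcons eq /= /step /= E.
+ by rewrite pos_rcons.
+ by rewrite -cats1 count_cat addn0.
exact: represents_right.
Qed.

Lemma state_node q C S : state_at g st0 q = Some (C, S) ->
  exists J N, [/\ mv_node I T (pos q) (count negb q) J (pivot_tree N C S),
    represents J (C, S) & (size S <= N)%N].
Proof.
elim/last_ind: q C S => [|q b IH] C S.
  move=> [e]; exists I, (size st0.2); move: g0 rI; rewrite /T e => gst rJ.
  by split=> //; apply: mv_root.
rewrite state_at_rcons; case E: (state_at g st0 q) => [[C' S']|] //= eq.
have [J [N [nJ rJ le]]] := IH _ _ E; have [gst _ _ _ _] := state_at_invariants g0 E.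
case: S' E gst nJ rJ le eq => [|i S'] // E gst nJ rJ.
case: N nJ => // N nJ; rewrite ltnS => le.
rewrite /step /=; case En: (nilp S') => //= -[].
move: nJ => /=; rewrite En => nJ.
rewrite pos_rcons -cats1 count_cat; case: b => -[<- <-].
  exists (right_child J (label_lcm g C' i)), N; split=> //; last exact: represents_right.
  by rewrite addn0; apply: mv_right nJ.
exists (left_child J (label_lcm g C' i)), N; split; last 2 first.
- exact: represents_left.
- exact: leq_trans (size_minimals _ _) le.
by rewrite addn0 addn1; apply: mv_left nJ.
Qed.

Lemma pivot_tree_mv : mayer_vietoris_tree I T.
Proof.
move=> p d J t /node_state [q [N [C [S [eq _ _ rJ [-> le]]]]]].
have [gst _ _ _ _] := state_at_invariants g0 eq.
have mg m := represents_min_gen m gst rJ.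
case: N S {eq rJ} gst mg le => [|N] [|i S]; try by case.
move=> [/= /andP [iS uS] _ _ anti] mg _; case: nilP => [e|].
  exists (label_lcm g C i); split; first by apply/mg; exists i; rewrite ?inE ?eqxx.
  by move=> m /mg [j]; rewrite e inE => /eqP -> ->.
case: S iS uS anti mg => // j S iS uS anti mg _.
have iij : i \in [:: i, j & S] by rewrite inE eqxx.
have jij : j \in [:: i, j & S] by rewrite !inE eqxx orbT.
split; first by apply/mg; exists i.
exists (label_lcm g C j); split; first by apply/mg; exists j.
move=> e; have ij : j = i by apply: anti => //; rewrite e lepm_refl.
by rewrite -ij !inE eqxx in iS.
Qed.

Lemma rel_gen_occurs p d a : rel_gen I T p d a <->
  exists q s, [/\ p = pos q, d = count negb q, occurs g st0 q s & a = lcm_of g s].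
Proof.
split=> [[rp [J [t [/node_state [q [N [C [S [eq ep -> rJ _]]]]] mJ]]]]|].
  have [gst _ _ _ _] := state_at_invariants g0 eq.
  have [i iS ->] := (represents_min_gen a gst rJ).1 mJ.
  exists q, (i |: C); split=> //; split; first by rewrite -relevant_pos -ep.
  by exists C, S, i.
case=> q [s [-> -> [rq [C [S [i [eq iS ->]]]]] ->]].
have [gst _ _ _ _] := state_at_invariants g0 eq.
have [J [N [nJ rJ _]]] := state_node eq.
split; first by rewrite relevant_pos.
exists J, (pivot_tree N C S); split=> //; apply/(represents_min_gen _ gst rJ).
by exists i.
Qed.

End Root.

End Nodes.

(** * Scarf ideals are of type B1 *)

Section ScarfIdeals.

Variables (k : fieldType) (n r : nat) (I : ideal k n) (g : 'I_r -> 'X_{1..n}).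
Hypotheses (mI : monomial_ideal I) (gI : min_gens I g).

Implicit Types s t : {set 'I_r}.

Let st0 : state r := (set0, enum 'I_r).

Lemma label_lcm0 i : label_lcm g set0 i = g i.
Proof. by rewrite /label_lcm setU0 lcm_of1. Qed.

Lemma covers0 b : covers g set0 (enum 'I_r) b = [exists i, (g i <= b)%MM].
Proof.
apply/hasP/existsP=> [[i _]|[i le]]; first by rewrite label_lcm0; exists i.
by exists i; rewrite ?mem_enum // label_lcm0.
Qed.

Lemma represents_root : represents g I st0.
Proof.
move=> b; rewrite covers0; split=> [/(mem_idealX mI gI) [i le]|/existsP h].
  by apply/existsP; exists i.
exact/(mem_idealX mI gI).
Qed.

Lemma good_state_root : good_state g st0.
Proof.
split=> /=; first exact: enum_uniq.
- have [[f [If nf]] _] := mI; apply/eqP=> e.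
  have /(_ (mlead f)) := represents_root.
  have -> /= : covers g st0.1 st0.2 (mlead f) = false by rewrite /st0 /= e.
  case=> h _; suff // : false by [].
  apply: h; apply: monomial_ideal_msupp mI If _; apply: mlead_supp; exact/eqP.
- by move=> i _; rewrite inE.
move=> i j _ _; rewrite !label_lcm0 => le; apply: gI.1.
have [Ii _] := (gI.2 (g i)).2 (ex_intro _ i erefl).
have [_ h] := (gI.2 (g j)).2 (ex_intro _ j erefl).
exact: h.
Qed.

Variable G : mgseq k n.
Hypothesis rG : resolved_by_scarf_faces I g G.

Let root_labels := labels g r set0 (enum 'I_r).

(** Both signed counts have the same sums over the divisors of every x^b, namely
    the indicator of I. *)
Lemma label_count a :
  \sum_(s <- root_labels | lcm_of g s == a) (-1) ^+ #|s|.-1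
  = \sum_(s in nonempty_scarf g | lcm_of g s == a) (-1) ^+ #|s|.-1 :> int.
Proof.
have ul : uniq root_labels.
  by apply: uniq_labels; [exact: enum_uniq|move=> i _; rewrite inE].
have l0 s : s \in root_labels -> (0 < #|s|)%N.
  by move=> /labels_bounds [_ _ [i _ is_]]; apply/card_gt0P; exists i.
pose w s : int :=
  (-1) ^+ #|s|.-1 * ((s \in root_labels)%:R - (s \in nonempty_scarf g)%:R).
have wE (P : pred {set 'I_r}) : \sum_(s | P s) w s =
    \sum_(s <- root_labels | P s) (-1) ^+ #|s|.-1
    - \sum_(s in nonempty_scarf g | P s) (-1) ^+ #|s|.-1.
  under eq_bigr do rewrite /w mulrBr.
  rewrite big_split /= sumrN -[in RHS]big_filter.
  rewrite [X in _ = X - _]big_uniq ?filter_uniq //=.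
  congr (_ - _).
    rewrite (bigID (fun s => s \in root_labels)) /= [X in _ + X]big1 ?addr0.
      apply: eq_big => [s|s /andP [_ ->]]; first by rewrite mem_filter.
      by rewrite mulr1.
    by move=> s /andP [_ /negbTE ->]; rewrite mulr0.
  rewrite (bigID (fun s => s \in nonempty_scarf g)) /= [X in _ + X]big1 ?addr0.
    apply: eq_big => [s|s /andP [_ ->]]; first by rewrite andbC.
    by rewrite mulr1.
  by move=> s /andP [_ /negbTE ->]; rewrite mulr0.
suff: \sum_(s | lcm_of g s == a) w s = 0 by rewrite wE => /eqP; rewrite subr_eq0 => /eqP.
move: a; apply: moebius_degree => b; rewrite wE (euler_scarf mI gI b rG) -covers0.
have e : \sum_(s <- root_labels | (lcm_of g s <= b)%MM) (-1) ^+ #|s|.-1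
    = - \sum_(s <- root_labels | (lcm_of g s <= b)%MM) (-1) ^+ #|s| :> int.
  rewrite -sumrN big_seq_cond [RHS]big_seq_cond.
  by apply: eq_bigr => s /andP [/l0 s0 _]; rewrite -{2}(prednK s0) exprS mulN1r opprK.
rewrite e labels_euler ?size_enum_ord ?enum_uniq //; last by move=> i _; rewrite inE.
by rewrite cards0 expr1 mulN1r opprK subrr.
Qed.

Lemma scarf_type_B1 : type_B1 I.
Proof.
exists (pivot_tree g (size st0.2) st0.1 st0.2); split.
  exact: pivot_tree_mv good_state_root represents_root.
move=> i a; rewrite (betti_scarf mI i a rG).
have occE p d := rel_gen_occurs good_state_root represents_root p d a.
have lblP s : s \in root_labels <-> exists q, occurs g st0 q s.
  by apply: labels_occurs; rewrite size_enum_ord.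
have card_occ q s : occurs g st0 q s -> #|s| = (count negb q).+1.
  case=> _ [C [S [j [eq jS ->]]]].
  have [[_ _ dC _] _ _ _ c] := state_at_invariants good_state_root eq.
  by rewrite cardsU1 (dC j jS) c cards0.
have [/existsP [s /andP [sN /andP [/eqP cs /eqP ms]]]|none] :=
    boolP [exists s in nonempty_scarf g, (#|s| == i.+1) && (lcm_of g s == a)].
  have [s0 scarf] := nonempty_scarfP g s sN.
  rewrite (_ : [set _ in _ | _] = [set s]) ?cards1; last first.
    apply/setP=> t; rewrite !inE; apply/idP/eqP=> [/and3P [/andP [t0 _] _ /eqP mt]|->].
      by apply/esym/scarf; rewrite // mt.
    by move: sN; rewrite inE => ->; rewrite cs ms !eqxx.
  have /lblP [q oq] : s \in root_labels.
    apply: scarf_labels; rewrite ?size_enum_ord ?enum_uniq //.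
    - by move=> j _; rewrite inE.
    - by rewrite proper0.
    by apply/subsetP=> j _; rewrite !inE mem_enum orbT.
  rewrite /bbar; case: excluded_middle_informative => // h; case: h.
  have dq : i = count negb q by have := card_occ _ _ oq; rewrite cs => -[].
  exists (pos q); split; first by apply/occE; exists q, s.
  move=> p d /occE [q' [t [-> _ ot mt]]]; congr pos.
  have t0 : t != set0 by rewrite -card_gt0 (card_occ _ _ ot).
  have st : s = t by apply: scarf; rewrite // ms.
  by rewrite st in oq; apply: occurs_unique ot oq; apply: good_state_root.
rewrite eq_card0; last first.
  move=> s; apply: contraNF none; rewrite inE => h; apply/existsP; exists s.
  exact: h.
rewrite /bbar; case: excluded_middle_informative => // h; exfalso.
case: h => p [/occE [q [s [ep ed oq ms]]] uq].
(* Another label with lcm a sits at the same node, whose generators are distinct. *)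
have same t : t \in root_labels -> lcm_of g t = a -> t = s.
  move=> /lblP [q' oq'] mt.
  have /pos_inj eq : pos q' = pos q.
    by rewrite -ep; apply: (uq _ (count negb q')); apply/occE; exists q', t.
  rewrite {}eq in oq'; case: oq' oq mt ms => _ [C [S [j [eC jS ->]]]].
  case=> _ [C' [S' [j' [eC' jS' ->]]]]; move: eC' jS'; rewrite eC => -[<- <-] jS' mt ms.
  have [[_ _ _ anti] _ _ _ _] := state_at_invariants good_state_root eC.
  by rewrite (anti j j' jS jS') // /label_lcm mt ms lepm_refl.
have sl : s \in root_labels by apply/lblP; exists q.
(* The count over labels is a single sign, the count over faces is empty. *)
have := label_count a; rewrite [in RHS]big1; last first.
  move=> t /andP [tN /eqP mt]; case/negP: none; apply/existsP; exists t.
  have tl : t \in root_labels.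
    apply: scarf_labels; rewrite ?size_enum_ord ?enum_uniq //.
    - by move=> j _; rewrite inE.
    - by rewrite proper0; have [] := nonempty_scarfP g t tN.
    by apply/subsetP=> j _; rewrite !inE mem_enum orbT.
  by rewrite tN (same t tl mt) (card_occ _ _ oq) -ed -ms !eqxx.
rewrite big_mkcond (bigD1_seq s) //=; last first.
  by apply: uniq_labels; [exact: enum_uniq|move=> j _; rewrite inE].
rewrite -ms eqxx [X in _ + X]big1_seq ?addr0; last first.
  move=> t /andP [ne tl]; case: eqP => // mt.
  by rewrite (same t tl) ?eqxx ?ms // in ne; rewrite mt.
by move/eqP; rewrite signr_eq0.
Qed.

End ScarfIdeals.

Theorem proposition4p1p11 (k : fieldType) (k_char0 : [pchar k] =i pred0)
    (n : nat) (I : ideal k n) :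
  scarf_ideal I -> type_B1 I.
Proof.
case=> mI [r [g [gI rF mF]]].
have [G rG] := scarf_ideal_resolution mI gI rF mF.
exact: scarf_type_B1 rG.
Qed.
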